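(* Let $n\ge1$ and $p>1$ be integers and let $f:\mathbb{R}^n\to\mathbb{R}$ satisfy: (i) $f$ is $p$ times continuously differentiable on $\mathbb{R}^n$; (ii) there is a constant $f_{\rm low}$ with $f(x)\ge f_{\rm low}$ for all $x\in\mathbb{R}^n$; (iii) there is a constant $L_p\ge 0$ with $\|\nabla_x^p f(x)-\nabla_x^p f(y)\|\le L_p\|x-y\|$ for all $x,y\in\mathbb{R}^n$; (iv) there is a constant $\kappa_{\rm high}\le 0$ with $\min_{\|d\|\le 1}\nabla_x^i f(x)[d]^i\ge \kappa_{\rm high}$ for all $x\in\mathbb{R}^n$ and all $i\in\{2,\dots,p\}$. Then the MOFFAR$p$ algorithm requires at most $$\left[\kappa_{\rm MOFFARp}\left(f(x_0)-f_{\rm low}+\frac{1}{(p+1)!}\left(\frac{L_p}{\sigma_0}\nu_{\max}+\vartheta\sigma_0\right)\right)+\frac{2L_p}{\kappa_{\rm both}^{p+1}\vartheta}\max\left[\left(\frac{2L_p}{\vartheta}\right)^{\frac1p},\left(\frac{2L_p}{\vartheta}\right)^{\frac{2}{p-1}}\right]\right]\max\left[\epsilon_1^{-\frac{p+1}{p}},\epsilon_2^{-\frac{p+1}{p-1}}\right]+2$$ iterations and evaluations of $\{\nabla_x^i f\}_{i=1}^p$ to produce a vector $x_\epsilon\in\mathbb{R}^n$ such that $\|g(x_\epsilon)\|\le\epsilon_1$ and $\lambda_{\min}[\nabla_x^2f(x_\epsilon)]\ge-\epsilon_2$, where $$\kappa_{\rm MOFFARp}=2(p+1)!\max\left[\sigma_{\max}^{\frac1p}\left(\frac{\frac{L_p}{\sigma_0}+\vartheta\theta_1}{\vartheta\,p!}\right)^{\frac{p+1}{p}},\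 \sigma_{\max}^{\frac{2}{p-1}}\left(\frac{\frac{L_p}{\sigma_0}+\vartheta\theta_2}{\vartheta\,(p-1)!}\right)^{\frac{p+1}{p-1}}\right].$$
   Context: Notation: $\|\cdot\|$ is the Euclidean norm on $\mathbb{R}^n$ (and the induced operator norm for tensors); $\nabla_x^i f(x)$ is the $i$th derivative tensor of $f$ at $x$, and $T[d]^i$ is the tensor $T$ applied to $i$ copies of $d$; $\lambda_{\min}[\cdot]$ is the smallest eigenvalue; $g(x)=\nabla_x^1 f(x)$, $g_k=g(x_k)$. The Taylor expansion is $T_{f,p}(x,s)=f(x)+\sum_{i=1}^p\frac{1}{i!}\nabla_x^i f(x)[s]^i$, $\nabla_s^iT_{f,p}$ denotes its $i$th derivative in $s$, and the regularized model is $m_k(s)=T_{f,p}(x_k,s)+\frac{\sigma_k}{(p+1)!}\|s\|^{p+1}$. MOFFAR$p$ algorithm ($p\ge2$). Inputs: $x_0\in\mathbb{R}^n$, $\nu_0>0$, $\epsilon_1,\epsilon_2\in(0,1]$, $\theta_1,\theta_2>1$, $\vartheta\in(0,1]$. Set $k=0$. Step 1: evaluate $g_k$ and $\nabla_x^2f(x_k)$; terminate with $x_\epsilon=x_k$ if $\|g_k\|\le\epsilon_1$ and $\lambda_{\min}[\nabla_x^2f(x_k)]\ge-\epsilon_2$; else evaluate $\{\nabla_x^if(x_k)\}_{i=3}^p$. Step 2: if $k>0$, set $\mu_{1,k}=\frac{p!\,\|g_k\|}{\|s_{k-1}\|^p}-\theta_1\sigma_{k-1}$ and $\mu_{2,k}=\frac{(p-1)!\max[0,-\lambda_{\min}[\nabla_x^2f(x_k)]]}{\|s_{k-1}\|^{p-1}}-\theta_2\sigma_{k-1}$,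 and select any $\sigma_k\in[\vartheta\nu_k,\max(\nu_k,\mu_{1,k},\mu_{2,k})]$; if $k=0$, set $\sigma_0=\mu_{1,0}=\mu_{2,0}=\nu_0$. Then compute any step $s_k$ with $m_k(s_k)-m_k(0)<0$, $\|\nabla_s^1T_{f,p}(x_k,s_k)\|\le\theta_1\frac{\sigma_k}{p!}\|s_k\|^p$ and $\lambda_{\min}[\nabla_s^2T_{f,p}(x_k,s_k)]\ge-\theta_2\frac{\sigma_k}{(p-1)!}\|s_k\|^{p-1}$. Step 3: set $x_{k+1}=x_k+s_k$, $\nu_{k+1}=\nu_k+\nu_k\|s_k\|^{p+1}$, increment $k$ by one and return to Step 1. Constants: $$\eta=\sum_{i=2}^p\left[\frac{\max[0,-\kappa_{\rm high}](p+1)!}{i!\,\vartheta\nu_0}\right]^{\frac{1}{p-i+1}},$$ $$\kappa_1=1+2^{2p+1}\eta^{p+1}+2^{2p+1}\left[\frac{p+1}{\vartheta}\left((1+\theta_1)\frac{L_p}{\sigma_0}+\theta_1\right)\right]^{\frac{p+1}{p}},$$ $$\nu_{\max}=\max\left[\sigma_0+\sigma_0\left(2\eta+2\left(\frac{(p+1)!\,\|g_0\|}{\sigma_0}\right)^{\frac1p}\right)^{p+1},\ \frac{2\kappa_1L_p}{\vartheta}\right],$$ $$\sigma_{\max}=\max\left[\frac{2(p+1)!}{\vartheta}\left(f(x_0)-f_{\rm low}+\frac{1}{(p+1)!}\left(\frac{L_p}{\sigma_0}\nu_{\max}+\vartheta\sigma_0\right)\right)+\nu_{\max},\ L_p,\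 \nu_0\right],$$ $$\kappa_{\rm both}=\min\left[\left(\frac{p!}{(1+\theta_1)\frac{L_p}{\sigma_0}+\theta_1}\right)^{\frac1p},\left(\frac{(p-1)!}{(1+\theta_2)\frac{L_p}{\sigma_0}+\theta_2}\right)^{\frac{1}{p-1}}\right].$$ *)

(* Defs.v *)
From HB Require Import structures.
From mathcomp Require Import all_boot all_order all_algebra.
From mathcomp Require Import all_classical all_reals all_analysis.

Set Implicit Arguments.
Unset Strict Implicit.
Unset Printing Implicit Defensive.

Import Order.TTheory GRing.Theory Num.Theory.
Import numFieldNormedType.Exports.

Local Open Scope classical_set_scope.
Local Open Scope ring_scope.

(* The library norm on 'rV[R]_n is the sup norm; it defines the topology used
   by [continuous] and [differentiable].  All the estimates of the theorem are
   in the Euclidean norm. *)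
Definition enorm (R : realType) (n : nat) (v : 'rV[R]_n) : R :=
  Num.sqrt (\sum_i v 0 i ^+ 2).

(* [Ck p f]: f is p times continuously differentiable on R^n.  In finite
   dimension the Frechet derivative is of class C^k if and only if all the
   directional derivatives x |-> 'D_v f x are. *)
Fixpoint Ck (R : realType) (n p : nat) (f : 'rV[R]_n -> R) : Prop :=
  if p is q.+1 then
    (forall x, differentiable f x) /\ (forall v, Ck q ('D_v f))
  else continuous f.

(* The i-th derivative tensor, as the i-linear form
   (v_1, ..., v_i) |-> D_{v_1} ... D_{v_i} f (x). *)
Definition nabla (R : realType) (n i : nat) (f : 'rV[R]_n -> R) (x : 'rV[R]_n)
    : i.-tuple 'rV[R]_n -> R :=
  fun vs => foldr (fun v h => 'D_v h) f vs x.

(* T[d]^i *)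
Definition tapp (R : realType) (n i : nat) (T : i.-tuple 'rV[R]_n -> R)
    (d : 'rV[R]_n) : R :=
  T (nseq_tuple i d).

(* The operator norm max { |T[v_1, ..., v_i]| : ||v_j|| <= 1 for all j }; the
   set is bounded for every multilinear T. *)
Definition tnorm (R : realType) (n i : nat) (T : i.-tuple 'rV[R]_n -> R) : R :=
  sup [set `|T vs| | vs in
        [set vs : i.-tuple 'rV[R]_n | forall j, enorm (tnth vs j) <= 1]].

Definition gradient (R : realType) (n : nat) (f : 'rV[R]_n -> R)
    (x : 'rV[R]_n) : 'rV[R]_n :=
  \row_i 'D_(delta_mx 0 i) f x.

Definition hessian (R : realType) (n : nat) (f : 'rV[R]_n -> R)
    (x : 'rV[R]_n) : 'M[R]_n :=
  \matrix_(i, j) 'D_(delta_mx 0 i) ('D_(delta_mx 0 j) f) x.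

(* The set of eigenvalues is finite, and nonempty when A is symmetric of
   positive size, so that the infimum is then a minimum. *)
Definition lambda_min (R : realType) (n : nat) (A : 'M[R]_n) : R :=
  inf [set a | eigenvalue A a].

(* T_{f,p}(x, s) *)
Definition taylor (R : realType) (n p : nat) (f : 'rV[R]_n -> R)
    (x s : 'rV[R]_n) : R :=
  f x + \sum_(1 <= i < p.+1) (i`!%:R)^-1 * tapp (@nabla R n i f x) s.

(* m_k(s), for x = x_k and sigma = sigma_k *)
Definition model (R : realType) (n p : nat) (f : 'rV[R]_n -> R)
    (x : 'rV[R]_n) (sigma : R) (s : 'rV[R]_n) : R :=
  taylor p f x s + sigma / (p.+1)`!%:R * enorm s ^+ p.+1.

Definition second_order_point (R : realType) (n : nat) (f : 'rV[R]_n -> R)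
    (eps1 eps2 : R) (x : 'rV[R]_n) : Prop :=
  enorm (gradient f x) <= eps1 /\ - eps2 <= lambda_min (hessian f x).

Definition mu1 (R : realType) (n p : nat) (f : 'rV[R]_n -> R) (nu0 theta1 : R)
    (x s : nat -> 'rV[R]_n) (sigma : nat -> R) (k : nat) : R :=
  if k is j.+1 then
    p`!%:R * enorm (gradient f (x k)) / enorm (s j) ^+ p - theta1 * sigma j
  else nu0.

Definition mu2 (R : realType) (n p : nat) (f : 'rV[R]_n -> R) (nu0 theta2 : R)
    (x s : nat -> 'rV[R]_n) (sigma : nat -> R) (k : nat) : R :=
  if k is j.+1 then
    (p.-1)`!%:R * Num.max 0 (- lambda_min (hessian f (x k)))
      / enorm (s j) ^+ p.-1 - theta2 * sigma j
  else nu0.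

Definition step_conditions (R : realType) (n p : nat) (f : 'rV[R]_n -> R)
    (theta1 theta2 : R) (x : 'rV[R]_n) (sigma : R) (s : 'rV[R]_n) : Prop :=
  [/\ model p f x sigma s - model p f x sigma 0 < 0,
      enorm (gradient (taylor p f x) s)
        <= theta1 * (sigma / p`!%:R) * enorm s ^+ p
    & - (theta2 * (sigma / (p.-1)`!%:R) * enorm s ^+ p.-1)
        <= lambda_min (hessian (taylor p f x) s)].

(* A step is computed at iteration k only if none of x_0, ..., x_k passes the
   termination test [second_order_point], so the sequences are unconstrained
   after termination.  sigma_0 = nu_0 is imposed even if x_0 passes the test,
   because sigma_0 occurs in the complexity bound. *)
Definition moffar_run (R : realType) (n p : nat) (f : 'rV[R]_n -> R)
    (x0 : 'rV[R]_n) (nu0 eps1 eps2 theta1 theta2 vtheta : R)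
    (x s : nat -> 'rV[R]_n) (sigma nu : nat -> R) : Prop :=
  [/\ x 0%N = x0, nu 0%N = nu0, sigma 0%N = nu0
    & forall k : nat,
      (forall j : nat, (j <= k)%N -> ~ second_order_point f eps1 eps2 (x j)) ->
      [/\ (0 < k)%N ->
            vtheta * nu k <= sigma k
              <= Num.max (nu k) (Num.max (mu1 p f nu0 theta1 x s sigma k)
                                         (mu2 p f nu0 theta2 x s sigma k)),
          step_conditions p f theta1 theta2 (x k) (sigma k) (s k),
          x k.+1 = x k + s k
        & nu k.+1 = nu k + nu k * enorm (s k) ^+ p.+1]].

Definition eta (R : realType) (p : nat) (khigh vtheta nu0 : R) : R :=
  \sum_(2 <= i < p.+1)
    (Num.max 0 (- khigh) * (p.+1)`!%:R / (i`!%:R * vtheta * nu0))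
      `^ (1 / (p - i + 1)%N%:R).

Definition kappa1 (R : realType) (p : nat)
    (Lp khigh theta1 vtheta nu0 sigma0 : R) : R :=
  1 + 2 ^+ (2 * p + 1)%N * eta p khigh vtheta nu0 ^+ p.+1
    + 2 ^+ (2 * p + 1)%N
      * (p.+1%:R / vtheta * ((1 + theta1) * (Lp / sigma0) + theta1))
          `^ (p.+1%:R / p%:R).

(* normg0 stands for ||g_0||. *)
Definition nu_max (R : realType) (p : nat)
    (normg0 Lp khigh theta1 vtheta nu0 sigma0 : R) : R :=
  Num.max
    (sigma0 + sigma0 * (2 * eta p khigh vtheta nu0
       + 2 * ((p.+1)`!%:R * normg0 / sigma0) `^ (1 / p%:R)) ^+ p.+1)
    (2 * kappa1 p Lp khigh theta1 vtheta nu0 sigma0 * Lp / vtheta).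

(* f(x_0) - f_low + (L_p / sigma_0 * nu_max + vtheta * sigma_0) / (p+1)!,
   which occurs in both sigma_max and the complexity bound; gap stands for
   f(x_0) - f_low. *)
Definition total_gap (R : realType) (p : nat)
    (gap normg0 Lp khigh theta1 vtheta nu0 sigma0 : R) : R :=
  gap + 1 / (p.+1)`!%:R
    * (Lp / sigma0 * nu_max p normg0 Lp khigh theta1 vtheta nu0 sigma0
       + vtheta * sigma0).

Definition sigma_max (R : realType) (p : nat)
    (gap normg0 Lp khigh theta1 vtheta nu0 sigma0 : R) : R :=
  Num.max
    (2 * (p.+1)`!%:R / vtheta
       * total_gap p gap normg0 Lp khigh theta1 vtheta nu0 sigma0
     + nu_max p normg0 Lp khigh theta1 vtheta nu0 sigma0)
    (Num.max Lp nu0).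

Definition kappa_both (R : realType) (p : nat)
    (Lp theta1 theta2 sigma0 : R) : R :=
  Num.min
    ((p`!%:R / ((1 + theta1) * (Lp / sigma0) + theta1)) `^ (1 / p%:R))
    (((p.-1)`!%:R / ((1 + theta2) * (Lp / sigma0) + theta2))
       `^ (1 / p.-1%:R)).

Definition kappa_moffar (R : realType) (p : nat)
    (gap normg0 Lp khigh theta1 theta2 vtheta nu0 sigma0 : R) : R :=
  let smax := sigma_max p gap normg0 Lp khigh theta1 vtheta nu0 sigma0 in
  2 * (p.+1)`!%:R
    * Num.max
        (smax `^ (1 / p%:R)
         * ((Lp / sigma0 + vtheta * theta1) / (vtheta * p`!%:R))
             `^ (p.+1%:R / p%:R))
        (smax `^ (2 / p.-1%:R)
         * ((Lp / sigma0 + vtheta * theta2) / (vtheta * (p.-1)`!%:R))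
             `^ (p.+1%:R / p.-1%:R)).

Definition moffar_bound (R : realType) (p : nat)
    (gap normg0 Lp khigh eps1 eps2 theta1 theta2 vtheta nu0 sigma0 : R) : R :=
  (kappa_moffar p gap normg0 Lp khigh theta1 theta2 vtheta nu0 sigma0
     * total_gap p gap normg0 Lp khigh theta1 vtheta nu0 sigma0
   + 2 * Lp / (kappa_both p Lp theta1 theta2 sigma0 ^+ p.+1 * vtheta)
     * Num.max ((2 * Lp / vtheta) `^ (1 / p%:R))
               ((2 * Lp / vtheta) `^ (2 / p.-1%:R)))
  * Num.max (eps1 `^ (- (p.+1%:R / p%:R))) (eps2 `^ (- (p.+1%:R / p.-1%:R)))
  + 2.

(* Main.v *)
Require Import Defs.
From HB Require Import structures.
From mathcomp Require Import all_boot all_order all_algebra.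
From mathcomp Require Import all_classical all_reals all_analysis.
From mathcomp Require Import ring lra.

(* Taylor's theorem with a Lipschitz p-th derivative, applied along segments to
   f, D_u f and D_u D_u f, bounds the errors of the model in value, gradient
   and least eigenvalue by multiples of L ||s||^(p+1), L ||s||^p and
   L ||s||^(p-1).  Hence
     (sigma_j - L) ||s_j||^(p+1) <= (p+1)! (f(x_j) - f(x_{j+1}))
   and sigma_j <= max(nu_j, L).  Let k1 be the first index with
   nu_k1 >= 2 L / vtheta.  From k1 on, L <= sigma_j / 2; before k1 the sum of
   L ||s_j||^(p+1) is at most (L / nu_0) nu_k1, and nu_k1 <= nu_max because one
   step multiplies nu by at most kappa_1.  So the sum over all j of
   sigma_j ||s_j||^(p+1) / 2 is at most (p+1)! total_gap, which bounds nu_j and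
   sigma_j by sigma_max.  A step that leads to a point failing the termination
   test contributes to that sum at least a fixed multiple of
   min(eps1^((p+1)/p), eps2^((p+1)/(p-1))), whence the bound on their number.
   As this argument also covers the steps before k1, it only uses that the
   kappa_both term of the bound is nonnegative. *)

Set Implicit Arguments.
Unset Strict Implicit.
Unset Printing Implicit Defensive.

Import Order.TTheory GRing.Theory Num.Theory.
Import numFieldNormedType.Exports.

Local Open Scope classical_set_scope.
Local Open Scope ring_scope.

(** * Euclidean norm *)

Definition edot (R : realType) (n : nat) (u v : 'rV[R]_n) : R :=
  \sum_i u 0 i * v 0 i.

Lemma edotC (R : realType) (n : nat) (u v : 'rV[R]_n) : edot u v = edot v u.
Proof. by apply: eq_bigr => i _; rewrite mulrC. Qed.

Lemma edotDl (R : realType) (n : nat) (u v w : 'rV[R]_n) :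
  edot (u + v) w = edot u w + edot v w.
Proof.
by rewrite /edot -big_split; apply: eq_bigr => i _; rewrite mxE mulrDl.
Qed.

Lemma edotZl (R : realType) (n : nat) (a : R) (u v : 'rV[R]_n) :
  edot (a *: u) v = a * edot u v.
Proof.
by rewrite /edot mulr_sumr; apply: eq_bigr => i _; rewrite mxE mulrA.
Qed.

Lemma edotDr (R : realType) (n : nat) (u v w : 'rV[R]_n) :
  edot u (v + w) = edot u v + edot u w.
Proof. by rewrite edotC edotDl !(edotC u). Qed.

Lemma edotZr (R : realType) (n : nat) (a : R) (u v : 'rV[R]_n) :
  edot u (a *: v) = a * edot u v.
Proof. by rewrite edotC edotZl edotC. Qed.

Lemma edotNr (R : realType) (n : nat) (u v : 'rV[R]_n) :
  edot u (- v) = - edot u v.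
Proof. by rewrite -scaleN1r edotZr mulN1r. Qed.

Lemma edotvv_ge0 (R : realType) (n : nat) (v : 'rV[R]_n) : 0 <= edot v v.
Proof. by apply: sumr_ge0 => i _; rewrite -expr2 sqr_ge0. Qed.

Lemma enorm_ge0 (R : realType) (n : nat) (v : 'rV[R]_n) : 0 <= enorm v.
Proof. exact: sqrtr_ge0. Qed.

Lemma enorm_sqr (R : realType) (n : nat) (v : 'rV[R]_n) :
  enorm v ^+ 2 = edot v v.
Proof.
rewrite /enorm sqr_sqrtr; last by apply: sumr_ge0 => i _; rewrite sqr_ge0.
by apply: eq_bigr => i _; rewrite expr2.
Qed.

Lemma enormE (R : realType) (n : nat) (v : 'rV[R]_n) :
  enorm v = Num.sqrt (edot v v).
Proof. by rewrite -enorm_sqr sqrtr_sqr ger0_norm ?enorm_ge0. Qed.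

Lemma enormZ (R : realType) (n : nat) (a : R) (v : 'rV[R]_n) :
  enorm (a *: v) = `|a| * enorm v.
Proof.
by rewrite !enormE edotZl edotZr mulrA -expr2 sqrtrM ?sqr_ge0// sqrtr_sqr.
Qed.

Lemma enorm0 (R : realType) (n : nat) : enorm (0 : 'rV[R]_n) = 0.
Proof. by rewrite -(scale0r (0 : 'rV[R]_n)) enormZ normr0 mul0r. Qed.

Lemma coord_le_enorm (R : realType) (n : nat) (v : 'rV[R]_n) (i : 'I_n) :
  `|v 0 i| <= enorm v.
Proof.
rewrite -sqrtr_sqr ler_wsqrtr// (bigD1 i)//= lerDl.
by apply: sumr_ge0 => j _; rewrite sqr_ge0.
Qed.

Lemma enorm_eq0 (R : realType) (n : nat) (v : 'rV[R]_n) :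
  (enorm v == 0) = (v == 0).
Proof.
apply/eqP/eqP => [v0|->]; last exact: enorm0.
apply/rowP => i; rewrite mxE; apply/normr0_eq0/le_anti/andP; split=> //.
by rewrite -v0 coord_le_enorm.
Qed.

Lemma enorm_gt0 (R : realType) (n : nat) (v : 'rV[R]_n) :
  (0 < enorm v) = (v != 0).
Proof. by rewrite lt_neqAle enorm_ge0 andbT eq_sym enorm_eq0. Qed.

Lemma enorm_normalize (R : realType) (n : nat) (v : 'rV[R]_n) :
  v != 0 -> enorm ((enorm v)^-1 *: v) = 1.
Proof.
move=> v0; rewrite enormZ ger0_norm ?invr_ge0 ?enorm_ge0// mulVf//.
by rewrite enorm_eq0.
Qed.

Lemma enorm_normalize_le1 (R : realType) (n : nat) (v : 'rV[R]_n) :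
  enorm ((enorm v)^-1 *: v) <= 1.
Proof.
by have [->|/enorm_normalize ->//] := eqVneq v 0; rewrite scaler0 enorm0.
Qed.

Lemma scale_enorm_normalize (R : realType) (n : nat) (v : 'rV[R]_n) :
  v = enorm v *: ((enorm v)^-1 *: v).
Proof.
have [->|v0] := eqVneq v 0; first by rewrite !scaler0.
by rewrite scalerA divff ?scale1r ?enorm_eq0.
Qed.

(** Cauchy-Schwarz: for nonzero u and v, the squared norm of ||v|| u - ||u|| v equals 2 ||u|| ||v||
    (||u|| ||v|| - <u, v>). *)
Lemma edot_le_enorm (R : realType) (n : nat) (u v : 'rV[R]_n) :
  edot u v <= enorm u * enorm v.
Proof.
have [->|u0] := eqVneq u 0.
  by rewrite enorm0 mul0r -(scale0r (0 : 'rV[R]_n)) edotZl mul0r.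
have [->|v0] := eqVneq v 0.
  by rewrite enorm0 mulr0 -(scale0r (0 : 'rV[R]_n)) edotZr mul0r.
have := edotvv_ge0 (enorm v *: u - enorm u *: v).
rewrite edotDl !edotDr -!scaleNr !edotZl !edotZr (edotC v u) -!enorm_sqr.
move: u0 v0; rewrite -!enorm_gt0; set a := enorm u; set b := enorm v.
set c := edot u v => a0 b0.
rewrite (_ : _ + _ = 2 * (a * b) * (a * b - c)); last by ring.
by rewrite pmulr_rge0 ?subr_ge0// !mulr_gt0.
Qed.

Lemma enormN (R : realType) (n : nat) (v : 'rV[R]_n) : enorm (- v) = enorm v.
Proof. by rewrite -scaleN1r enormZ normrN1 mul1r. Qed.

Lemma enormD_le (R : realType) (n : nat) (u v : 'rV[R]_n) :
  enorm (u + v) <= enorm u + enorm v.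
Proof.
rewrite -(@ler_pXn2r _ 2)// ?nnegrE ?addr_ge0 ?enorm_ge0//.
rewrite enorm_sqr edotDl !edotDr (edotC v u) -!enorm_sqr.
have := edot_le_enorm u v; lra.
Qed.

(* The direction of v realises ||v|| as an inner product. *)
Lemma enorm_le_edot (R : realType) (n : nat) (v : 'rV[R]_n) (c : R) :
  0 <= c -> (forall u, enorm u <= 1 -> edot u v <= c) -> enorm v <= c.
Proof.
move=> c0 /(_ _ (enorm_normalize_le1 v)); rewrite edotZl -enorm_sqr.
have [->|v0] := eqVneq v 0; first by rewrite enorm0.
by rewrite expr2 mulKf ?enorm_eq0.
Qed.

(** * Iterated directional derivatives *)

(** The two difference quotients are the same function of h. *)
Lemma is_derive_line (R : realType) (V : normedModType R) (f : V -> R)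
    (y v : V) (t : R) :
  derivable f (y + t *: v) v ->
  is_derive t 1 (fun r => f (y + r *: v)) ('D_v f (y + t *: v)).
Proof.
move=> df.
have E : (fun h : R => h^-1 *: (((fun r => f (y + r *: v)) \o shift t) (h *: 1)
             - f (y + t *: v))) =
         (fun h : R => h^-1 *: ((f \o shift (y + t *: v)) (h *: v)
             - f (y + t *: v))).
  apply/funext => h /=; congr (_ *: (f _ - _)).
  by rewrite [h *: 1]mulr1 scalerDl addrCA.
by apply: DeriveDef; rewrite /derivable /derive E.
Qed.

Lemma MVT_line (R : realType) (g dg : R -> R) (a b : R) : a < b ->
  (forall x : R, is_derive x (1 : R) g (dg x)) ->
  exists2 c, a < c < b & g b - g a = dg c * (b - a).
Proof.
move=> ab gd; have [|c] := MVT ab (fun x _ => gd x); last by exists c.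
apply: continuous_subspaceT => x; apply: differentiable_continuous.
by apply/derivable1_diffP; have := gd x.
Qed.

Lemma Ck_differentiable (R : realType) (n p : nat) (f : 'rV[R]_n -> R) :
  Ck p.+1 f -> forall x, differentiable f x.
Proof. by move=> []. Qed.

Lemma Ck_derive (R : realType) (n p : nat) (f : 'rV[R]_n -> R) (v : 'rV[R]_n) :
  Ck p.+1 f -> Ck p ('D_v f).
Proof. by move=> [_]; apply. Qed.

Lemma Ck_continuous (R : realType) (n p : nat) (f : 'rV[R]_n -> R) :
  Ck p f -> continuous f.
Proof.
by case: p => [fC|p [fd _] x]; [exact: fC|exact/differentiable_continuous/fd].
Qed.

Lemma CkS (R : realType) (n p : nat) (f : 'rV[R]_n -> R) : Ck p.+1 f -> Ck p f.
Proof.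
elim: p f => [|p IH] f fC; first exact: (Ck_continuous fC).
by split=> [|v]; [exact: Ck_differentiable fC|apply/IH/Ck_derive].
Qed.

Lemma Ck_leq (R : realType) (n p q : nat) (f : 'rV[R]_n -> R) :
  (q <= p)%N -> Ck p f -> Ck q f.
Proof.
by move=> /subnK <-; elim: (p - q)%N => [//|k IH] /CkS; exact: IH.
Qed.

Lemma deriveDZ (R : realType) (n : nat) (a : R) (f g : 'rV[R]_n -> R) v x :
  differentiable f x -> differentiable g x ->
  'D_v (fun x => a * f x + g x) x = a * 'D_v f x + 'D_v g x.
Proof.
move=> /diff_derivable df /diff_derivable dg.
rewrite (_ : (fun x => _) = a \*: f + g)//.
by rewrite deriveD ?deriveZ//; apply: derivableZ.
Qed.

Lemma CkDZ (R : realType) (n p : nat) (a : R) (f g : 'rV[R]_n -> R) :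
  Ck p f -> Ck p g -> Ck p (fun x => a * f x + g x).
Proof.
elim: p f g => [|p IH] f g fC gC.
  by move=> x; have := cvgD (cvgZl_tmp (k := a) (fC x)) (gC x); exact.
have [fd gd] := (Ck_differentiable fC, Ck_differentiable gC).
split=> [x|v].
  by rewrite (_ : (fun x => _) = a \*: f + g)//; apply: differentiableD;
    [apply: differentiableZ|].
rewrite (_ : 'D_v _ = (fun x => a * 'D_v f x + 'D_v g x)).
  by apply: IH; apply: Ck_derive.
by apply/funext => x; rewrite deriveDZ.
Qed.

Lemma Ck_cst (R : realType) (n p : nat) (c : R) :
  Ck p (fun _ : 'rV[R]_n => c).
Proof.
elim: p c => [|p IH] c; first exact: cst_continuous.
split=> [x|v]; first exact: differentiable_cst.
by rewrite (_ : 'D_v _ = fun _ => 0)//; apply/funext => x; exact: derive_cst.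
Qed.

Lemma derive_coord (R : realType) (n : nat) (f : 'rV[R]_n -> R)
    (v x : 'rV[R]_n) :
  differentiable f x -> 'D_v f x = \sum_j v 0 j * 'D_(delta_mx 0 j) f x.
Proof.
move=> df; rewrite deriveE// [v in 'd f x v]row_sum_delta linear_sum.
by apply: eq_bigr => j _; rewrite linearZ deriveE.
Qed.

(** * Derivatives along a list of directions *)

(** [nabla] on lists instead of tuples, so that directions can be concatenated and split without
    casts. The head of the list is differentiated last. *)
Definition dirderiv (R : realType) (n : nat) (vs : seq 'rV[R]_n)
    (f : 'rV[R]_n -> R) : 'rV[R]_n -> R :=
  foldr (fun v h => 'D_v h) f vs.

Lemma Ck_dirderiv (R : realType) (n q : nat) (vs : seq 'rV[R]_n)
    (f : 'rV[R]_n -> R) :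
  Ck (size vs + q) f -> Ck q (dirderiv vs f).
Proof.
elim: vs q => [//|v vs IH] q /= fC; apply: Ck_derive; apply: IH.
by rewrite addnS.
Qed.

Lemma dirderivDZ (R : realType) (n : nat) (vs : seq 'rV[R]_n) (a : R)
    (f g : 'rV[R]_n -> R) : Ck (size vs) f -> Ck (size vs) g ->
  dirderiv vs (fun x => a * f x + g x)
    = (fun x => a * dirderiv vs f x + dirderiv vs g x).
Proof.
elim: vs => [//|v vs IH] /= fC gC; rewrite IH; try exact: CkS.
apply/funext => x; rewrite deriveDZ//; apply: (@Ck_differentiable _ _ 0);
  by apply: Ck_dirderiv; rewrite addn1.
Qed.

Lemma dirderiv0 (R : realType) (n : nat) (vs : seq 'rV[R]_n) :
  dirderiv vs (fun _ => 0) = (fun _ => 0).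
Proof.
elim: vs => [//|v vs /= ->]; apply/funext => x; exact: derive_cst.
Qed.

(** Smoothness and formula are proved together: the inductive step applies [dirderivDZ] to the
    partial sum, whose smoothness it requires. *)
Lemma dirderiv_sum (R : realType) (n : nat) (vs : seq 'rV[R]_n) (I : Type)
    (r : seq I) (a : I -> R) (f : I -> 'rV[R]_n -> R) :
  (forall i, Ck (size vs) (f i)) ->
  Ck (size vs) (fun x => \sum_(i <- r) a i * f i x) /\
  dirderiv vs (fun x => \sum_(i <- r) a i * f i x)
    = (fun x => \sum_(i <- r) a i * dirderiv vs (f i) x).
Proof.
move=> fC; elim: r => [|i r [IHC IH]].
  rewrite (_ : (fun x => _) = fun _ => 0); last first.
    by apply/funext => x; rewrite big_nil.
  split; first exact: Ck_cst.
  by rewrite dirderiv0; apply/funext => x; rewrite big_nil.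
rewrite (_ : (fun x => _) =
    (fun x => a i * f i x + \sum_(i <- r) a i * f i x)); last first.
  by apply/funext => x; rewrite big_cons.
split; first exact: CkDZ.
by rewrite dirderivDZ// IH; apply/funext => x; rewrite big_cons.
Qed.

Lemma dirderiv_derive_coord (R : realType) (n : nat) (vs : seq 'rV[R]_n)
    (f : 'rV[R]_n -> R) (v x : 'rV[R]_n) : Ck (size vs).+1 f ->
  dirderiv vs ('D_v f) x
    = \sum_j v 0 j * dirderiv vs ('D_(delta_mx 0 j) f) x.
Proof.
move=> fC; rewrite (_ : 'D_v f = fun y => \sum_j v 0 j * 'D_(delta_mx 0 j) f y).
  by rewrite (dirderiv_sum _ _ _).2// => j; exact: Ck_derive.
by apply/funext => y; rewrite derive_coord//; exact: Ck_differentiable fC _.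
Qed.

(* The mean value theorem, applied along u and then along v, turns the second
   difference, which is symmetric in u and v, into a value of D_v D_u f. *)
Lemma second_difference (R : realType) (n : nat) (f : 'rV[R]_n -> R)
    (u v x : 'rV[R]_n) (e : R) :
  Ck 2 f -> 0 < e -> exists2 d, 0 < d & forall t, 0 < t < d ->
    `|(f (x + t *: u + t *: v) - f (x + t *: u) - f (x + t *: v) + f x) / t ^+ 2
        - 'D_v ('D_u f) x| < e.
Proof.
move=> fC e0; have /(_ x) := Ck_continuous (Ck_derive v (Ck_derive u fC)).
move=> /(@cvgrPdist_lt _ _ _ _ _ _ _).1 /(_ _ e0) /nbhs_normP [d /= d0 dP].
(* The displacement r u + q v below has norm at most t (|u| + |v|); the added 1 keeps the divisor
   positive when u = v = 0. *)
have c0 : 0 < `|u| + `|v| + 1 by rewrite ltr_wpDl ?addr_ge0.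
exists (d / (`|u| + `|v| + 1)); first by rewrite divr_gt0.
move=> t /andP[t0 td].
have fd := Ck_differentiable fC.
have fud := Ck_differentiable (Ck_derive u fC).
(* The increment of [g] over [0, t] is the second difference. It equals t times an increment of D_u
   f along v, to which the mean value theorem applies again. *)
pose g (r : R) := f (x + t *: v + r *: u) - f (x + r *: u).
have gd (r : R) : is_derive r (1 : R) g
    ('D_u f (x + t *: v + r *: u) - 'D_u f (x + r *: u)).
  by apply: is_deriveB; apply: is_derive_line; exact: diff_derivable.
have [r /andP[r0 rt]] := MVT_line t0 gd.
rewrite /g scale0r !addr0 subr0 => gE.
pose h (q : R) := 'D_u f (x + r *: u + q *: v).
have hd (q : R) : is_derive q (1 : R) h ('D_v ('D_u f) (x + r *: u + q *: v)).
  by apply: is_derive_line; exact: diff_derivable.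
have [q /andP[q0 qt]] := MVT_line t0 hd.
rewrite /h scale0r !addr0 subr0 => hE.
rewrite (_ : _ - _ + _ = 'D_v ('D_u f) (x + r *: u + q *: v) * t ^+ 2).
  rewrite mulfK ?expf_neq0 ?gt_eqF// distrC; apply: dP => /=.
  rewrite opprD addrA opprD addrA subrr sub0r -opprD normrN.
  rewrite (le_lt_trans (ler_normD _ _))// !normrZ !ger0_norm ?ltW//.
  apply: (@le_lt_trans _ _ (t * (`|u| + `|v| + 1))).
    rewrite mulrDr mulr1 -[X in X <= _]addr0 lerD ?(ltW t0)// mulrDr.
    by apply: lerD; apply: ler_wpM2r => //; exact: ltW.
  by rewrite -ltr_pdivlMr.
rewrite expr2 mulrA -hE.
rewrite (addrAC x (r *: u)) -gE (addrAC x (t *: v)).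
by rewrite opprB addrA addrAC -!addrA; congr (_ + _); rewrite addrCA.
Qed.

(** Schwarz's theorem: for small t, both mixed derivatives lie within e / 2 of the same symmetric
    second difference quotient. *)
Lemma derive_comm (R : realType) (n : nat) (f : 'rV[R]_n -> R)
    (u v : 'rV[R]_n) :
  Ck 2 f -> 'D_u ('D_v f) = 'D_v ('D_u f).
Proof.
move=> fC; apply/funext => x; apply/eqP; rewrite -subr_eq0 -normr_eq0.
apply/eqP/le_anti; rewrite normr_ge0 andbT; apply/ler_addgt0Pl => e e0.
rewrite addr0.
have e2 : 0 < e / 2 by rewrite divr_gt0.
have [d1 d10 P1] := second_difference u v x fC e2.
have [d2 d20 P2] := second_difference v u x fC e2.
have t0 : 0 < Num.min d1 d2 / 2 by rewrite divr_gt0// lt_min d10.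
set t := _ / 2 in t0.
have tm : t < Num.min d1 d2 by rewrite /t ltr_pdivrMr// mulr_natr mulr2n ltrDl
  lt_min d10.
have [td1 td2] : t < d1 /\ t < d2 by move: tm; rewrite lt_min => /andP.
have := P1 t; have := P2 t; rewrite t0 td1 td2 => /(_ isT) + /(_ isT).
rewrite (addrAC x (t *: v)) (addrAC _ (- f (x + t *: v)) (- f (x + t *: u))).
set q := _ / _ => A B.
move: A B; set a := 'D_v ('D_u f) x; set b := 'D_u ('D_v f) x.
move: q a b => q a b A B; rewrite (_ : b - a = q - a - (q - b)); last by ring.
rewrite (le_trans (ler_normB _ _))// [e]splitr lerD ?ltW//.
Qed.

Lemma dirderiv_derive (R : realType) (n : nat) (vs : seq 'rV[R]_n)
    (f : 'rV[R]_n -> R) (u : 'rV[R]_n) : Ck (size vs).+1 f ->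
  dirderiv vs ('D_u f) = 'D_u (dirderiv vs f).
Proof.
elim: vs => [//|v vs IH] /= fC; rewrite IH; last exact: CkS.
by apply: derive_comm; apply: Ck_dirderiv; rewrite addn2.
Qed.

(** Homogeneity in the leading directions only; the tail [vs] lets s be normalised while further
    fixed directions are present. *)
Lemma dirderiv_scale (R : realType) (n i : nat) (vs : seq 'rV[R]_n) (c : R)
    (f : 'rV[R]_n -> R) (s : 'rV[R]_n) : Ck (size vs + i) f ->
  dirderiv (nseq i (c *: s) ++ vs) f
    = (fun x => c ^+ i * dirderiv (nseq i s ++ vs) f x).
Proof.
elim: i => [|i IH] fC /=; first by apply/funext => x; rewrite expr0 mul1r.
rewrite IH; last by apply: CkS; rewrite -addnS.
apply/funext => x.
have fd y : differentiable (dirderiv (nseq i s ++ vs) f) y.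
  apply: (@Ck_differentiable _ _ 0); apply: Ck_dirderiv.
  by rewrite size_cat size_nseq addn1 addnC -addnS.
have -> : 'D_(c *: s) (fun x => c ^+ i * dirderiv (nseq i s ++ vs) f x) x
    = c ^+ i * 'D_(c *: s) (dirderiv (nseq i s ++ vs) f) x.
  by apply: deriveZ; exact: diff_derivable.
by rewrite !deriveE// linearZ exprSr -mulrA.
Qed.

(** * Taylor polynomials *)

(** The mean value theorem for h - g. It replaces integration in the Taylor estimate below. *)
Lemma le_of_derive_le (R : realType) (g h dg dh : R -> R) (a : R) :
  (forall x : R, is_derive x (1 : R) g (dg x)) ->
  (forall x : R, is_derive x (1 : R) h (dh x)) ->
  g 0 <= h 0 -> (forall t, 0 <= t <= a -> dg t <= dh t) ->
  forall t, 0 <= t <= a -> g t <= h t.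
Proof.
move=> gd hd gh0 dgh t /andP[]; rewrite le_eqVlt => /predU1P[<-//|t0] ta.
have [c /andP[c0 ct]] := MVT_line t0 (fun x => is_deriveB (hd x) (gd x)).
rewrite subr0 !fctE => E; have : 0 <= (dh c - dg c) * t.
  rewrite mulr_ge0// ?(ltW t0)// subr_ge0 dgh// (ltW c0)/=.
  exact: le_trans (ltW ct) ta.
by rewrite -E; lra.
Qed.

Lemma fact_neq0 (R : realType) (i : nat) : i`!%:R != 0 :> R.
Proof. by rewrite pnatr_eq0 -lt0n fact_gt0. Qed.

Lemma divr_factS (R : realType) (a : R) (i : nat) :
  a / (i.+1)`!%:R * i.+1%:R = a / i`!%:R.
Proof.
by rewrite factS natrM invfM mulrCA mulrAC mulVf ?mul1r ?pnatr_eq0.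
Qed.

(** Induction on q: the shifted family phi_1, phi_2, ... bounds the derivative of phi_0 - P by that
    of the monomial B, and comparing derivatives gains one order. *)
Lemma taylor1_remainder (R : realType) (q : nat) (phi : nat -> R -> R) (C : R) :
  (forall i (x : R), (i < q)%N -> is_derive x (1 : R) (phi i) (phi i.+1 x)) ->
  (forall t : R, 0 <= t <= 1 -> `|phi q t - phi q 0| <= C * t) ->
  forall t : R, 0 <= t <= 1 ->
    `|phi 0%N t - (\poly_(i < q.+1) (phi i 0 / i`!%:R)).[t]|
      <= C / (q.+1)`!%:R * t ^+ q.+1.
Proof.
elim: q phi => [|q IH] phi phid phiC t t01.
  by rewrite horner_poly big_ord1 expr0 mulr1 fact0 divr1 divr1 expr1 phiC.
pose P : {poly R} := \poly_(i < q.+2) (phi i 0 / i`!%:R).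
pose B : {poly R} := (C / (q.+2)`!%:R) *: 'X^(q.+2).
have dPE : P^`() = \poly_(i < q.+1) (phi i.+1 0 / i`!%:R).
  apply/polyP => i; rewrite coef_deriv !coef_poly ltnS; case: ifP => _;
    last by rewrite mul0rn.
  by rewrite -[_ *+ _]mulr_natr divr_factS.
have dBE x : B^`().[x] = C / (q.+1)`!%:R * x ^+ q.+1.
  rewrite derivZ derivXn hornerZ hornerMn hornerXn/=.
  rewrite -[_ ^+ _ *+ _]mulr_natl mulrA.
  by rewrite divr_factS.
have BE x : B.[x] = C / (q.+2)`!%:R * x ^+ q.+2 by rewrite hornerZ hornerXn.
have dP (x : R) : is_derive x (1 : R) (phi 0%N - horner P)
    (phi 1%N x - P^`().[x]).
  by apply: is_deriveB; exact: phid.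
have P0 : P.[0] = phi 0%N 0.
  by rewrite horner_coef0 coef_poly/= fact0 divr1.
have B0 : B.[0] = 0 by rewrite BE expr0n mulr0.
have IH' x : 0 <= x <= 1 -> `|phi 1%N x - P^`().[x]| <= B^`().[x].
  rewrite dPE dBE; apply: (IH (fun i => phi i.+1)) => // i y iq.
  exact: phid.
rewrite -/P -BE ler_norml; apply/andP; split.
- rewrite -hornerN -[X in _ <= X]/((phi 0%N - horner P) t).
  apply: (le_of_derive_le (a := 1) (is_derive_poly (- B)) dP) => //.
    by rewrite hornerN B0 oppr0 !fctE P0 subrr.
  by move=> x /IH'; rewrite derivN hornerN ler_norml => /andP[].
- rewrite -[X in X <= _]/((phi 0%N - horner P) t).
  apply: (le_of_derive_le (a := 1) dP (is_derive_poly B)) => //.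
    by rewrite B0 !fctE P0 subrr.
  by move=> x /IH'; rewrite ler_norml => /andP[].
Qed.

(** * Taylor polynomials in several variables *)

(** [taylor] with the constant term inside the sum and the order separated from the smoothness of f,
    so that it also serves for D_u f and D_d D_d f. *)
Definition taypoly (R : realType) (n q : nat) (h : 'rV[R]_n -> R)
    (x s : 'rV[R]_n) : R :=
  \sum_(i < q.+1) (i`!%:R)^-1 * dirderiv (nseq i s) h x.

Lemma taylorE (R : realType) (n p : nat) (f : 'rV[R]_n -> R) (x : 'rV[R]_n) :
  taylor p f x = taypoly p f x.
Proof.
apply/funext => s; rewrite /taylor /taypoly big_ord_recl/= fact0 invr1 mul1r.
by rewrite big_add1 big_mkord.
Qed.

(** The one-variable estimate on the segment from x to x + s, taken at its end t = 1. *)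
Lemma taypoly_remainder (R : realType) (n q : nat) (h : 'rV[R]_n -> R)
    (x s : 'rV[R]_n) (C : R) : Ck q h ->
  (forall t : R, 0 <= t <= 1 ->
    `|dirderiv (nseq q s) h (x + t *: s) - dirderiv (nseq q s) h x| <= C * t) ->
  `|h (x + s) - taypoly q h x s| <= C / (q.+1)`!%:R.
Proof.
move=> hC hL; pose phi i t := dirderiv (nseq i s) h (x + t *: s).
have := @taylor1_remainder R q phi C _ _ 1; rewrite ler01 lexx => H.
have {H} := H _ _ isT; rewrite /phi/= horner_poly scale1r expr1n mulr1.
rewrite (eq_bigr (fun i : 'I__ => (i`!%:R)^-1 * dirderiv (nseq i s) h x));
  last by move=> i _; rewrite scale0r addr0 expr1n mulr1 mulrC.
apply=> [i y iq|t t01]; last by rewrite scale0r addr0 hL.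
apply: is_derive_line; apply: diff_derivable.
apply: (@Ck_differentiable _ _ 0); apply: Ck_dirderiv.
by rewrite size_nseq addn1; exact: Ck_leq hC.
Qed.

Lemma derive_coord_fun (R : realType) (n : nat) (j : 'I_n)
    (u s : 'rV[R]_n) : 'D_u (fun v : 'rV[R]_n => v 0 j) s = u 0 j.
Proof.
apply: cvg_lim => //; apply: cvg_near_cst; near=> h.
rewrite /= !mxE addrK [_ *: _]mulKf//.
by near: h; exact: nbhs_dnbhs_neq.
Unshelve. all: by end_near. Qed.

Lemma dirderiv_nseqS (R : realType) (n i : nat) (h : 'rV[R]_n -> R)
    (x s : 'rV[R]_n) : Ck i.+1 h ->
  dirderiv (nseq i.+1 s) h x
    = \sum_j s 0 j * dirderiv (nseq i s) ('D_(delta_mx 0 j) h) x.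
Proof.
by move=> hC; rewrite -dirderiv_derive_coord ?dirderiv_derive ?size_nseq.
Qed.

(** Writing one of the copies of s in coordinates gives a sum of products s_j G_j(s) with G_j of
    degree i - 1; the product rule and induction apply to each. *)
Lemma derive_dirderiv_nseq (R : realType) (n i : nat) (h : 'rV[R]_n -> R)
    (x s : 'rV[R]_n) : Ck i h ->
  differentiable (fun s => dirderiv (nseq i s) h x) s /\
  forall u, 'D_u (fun s => dirderiv (nseq i s) h x) s
    = i%:R * dirderiv (nseq i.-1 s) ('D_u h) x.
Proof.
elim: i h => [|i IH] h hC.
  by split=> [|u]; [exact: differentiable_cst|rewrite mul0r; exact: derive_cst].
pose c (j : 'I_n) (v : 'rV[R]_n) : R := v 0 j.
pose G (j : 'I_n) (v : 'rV[R]_n) : R :=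
  dirderiv (nseq i v) ('D_(delta_mx 0 j) h) x.
have -> : (fun s => dirderiv (nseq i.+1 s) h x) = \sum_j (c j * G j).
  apply/funext => v; rewrite dirderiv_nseqS// fct_sumE.
  by apply: eq_bigr => j _.
have cd j : differentiable (c j) s by exact: differentiable_coord.
have [Gd GD] : (forall j, differentiable (G j) s) /\
    forall j u, 'D_u (G j) s
      = i%:R * dirderiv (nseq i.-1 s) ('D_u ('D_(delta_mx 0 j) h)) x.
  by split=> j; have [] := IH _ (Ck_derive (delta_mx 0 j) hC).
split=> [|u].
  by apply: differentiable_sum => j; exact: differentiableM.
rewrite derive_sum; last first.
  by move=> j; apply/diff_derivable/differentiableM.
rewrite (eq_bigr (fun j => i%:R * (s 0 j
      * dirderiv (nseq i.-1 s) ('D_u ('D_(delta_mx 0 j) h)) x)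
    + u 0 j * dirderiv (nseq i s) ('D_(delta_mx 0 j) h) x)); last first.
  move=> j _; rewrite deriveM; [|exact: diff_derivable..].
  rewrite GD derive_coord_fun -/(G j s) -/(c j s).
  rewrite -[LHS]/(c j s * (_ * _) + G j s * u 0 j).
  by rewrite mulrCA [G j s * _]mulrC.
rewrite big_split/= -mulr_sumr -natr1 mulrDl mul1r; congr (_ + _); last first.
  by rewrite dirderiv_derive_coord ?size_nseq.
(* With no direction left the factor i is 0. Otherwise h is of class C^2, and commuting u with the
   coordinate direction recombines the sum. *)
case: i IH hC G Gd GD => [|i] _ hC _ _ _; first by rewrite !mul0r.
congr (_ * _); rewrite dirderiv_nseqS; last exact: Ck_derive.
have hC2 : Ck 2 h by exact: Ck_leq hC.
apply: eq_bigr => j _.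
pose T g := s 0 j * dirderiv (nseq i s) g x.
exact (congr1 T (derive_comm u (delta_mx 0 j) hC2)).
Qed.

(** The factor i from the term of degree i turns 1/i! into 1/(i-1)!. Errors in the gradient and
    Hessian of the model thus become Taylor errors for derivatives of f. *)
Lemma taypoly_derive (R : realType) (n q : nat) (h : 'rV[R]_n -> R)
    (x s : 'rV[R]_n) : Ck q.+1 h ->
  differentiable (taypoly q.+1 h x) s /\
  forall u, 'D_u (taypoly q.+1 h x) s = taypoly q ('D_u h) x s.
Proof.
move=> hC; pose F (i : 'I_q.+2) (v : 'rV[R]_n) : R := dirderiv (nseq i v) h x.
have FC (i : 'I_q.+2) : Ck i h by apply: Ck_leq hC; rewrite -ltnS.
have Fd i : differentiable (F i) s := (derive_dirderiv_nseq x s (FC i)).1.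
have FD i u : 'D_u (F i) s = i%:R * dirderiv (nseq i.-1 s) ('D_u h) x
  := (derive_dirderiv_nseq x s (FC i)).2 u.
have -> : taypoly q.+1 h x = \sum_(i < q.+2) ((i`!%:R)^-1 : R) \*: F i.
  by apply/funext => v; rewrite fct_sumE.
have FZd (i : 'I_q.+2) : differentiable (((i`!%:R)^-1 : R) \*: F i) s.
  exact: differentiableZ.
split=> [|u]; first exact: differentiable_sum.
rewrite derive_sum => [|i]; last exact: diff_derivable.
rewrite big_ord_recl deriveZ ?FD; last exact: diff_derivable.
rewrite mul0r scaler0 add0r; apply: eq_bigr => i _.
rewrite deriveZ ?FD; last exact: diff_derivable.
rewrite -[LHS]/((lift ord0 i)`!%:R^-1 * ((lift ord0 i)%:R * _)) lift0 mulrA.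
by rewrite -[X in X * _ * _]mul1r divr_factS mul1r.
Qed.

(** * Tensor norms and the Taylor remainder *)

(** Expanding the innermost direction in coordinates, all at most 1 in absolute value, reduces the
    order by one. The bound makes the [sup] in [tnorm] a genuine upper bound. *)
Lemma dirderiv_bounded (R : realType) (n i : nat) (f : 'rV[R]_n -> R)
    (x : 'rV[R]_n) : Ck i f ->
  exists M, forall vs : seq 'rV[R]_n, size vs = i ->
    (forall v, v \in vs -> enorm v <= 1) -> `|dirderiv vs f x| <= M.
Proof.
elim: i f => [|i IH] f fC.
  by exists `|f x| => vs /size0nil ->.
have /fin_all_exists[M MP] (j : 'I_n) := IH _ (Ck_derive (delta_mx 0 j) fC).
exists (\sum_j M j); elim/last_ind => [//|vs v _] /[!size_rcons] -[vsi] vs1.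
rewrite /dirderiv foldr_rcons -/(dirderiv _ _) dirderiv_derive_coord ?vsi//.
rewrite (le_trans (ler_norm_sum _ _ _))// ler_sum// => j _; rewrite normrM.
rewrite (le_trans _ (MP j vs vsi _))//.
  rewrite ler_piMl// (le_trans (coord_le_enorm _ _))// vs1//.
  by rewrite mem_rcons mem_head.
by move=> w wvs; rewrite vs1// mem_rcons in_cons wvs orbT.
Qed.

Lemma dirderiv_lipschitz (R : realType) (n p : nat) (f : 'rV[R]_n -> R)
    (L : R) (x y : 'rV[R]_n) (vs : seq 'rV[R]_n) : Ck p f ->
  tnorm (fun vs : p.-tuple 'rV[R]_n => nabla f x vs - nabla f y vs)
    <= L * enorm (x - y) ->
  size vs = p -> (forall v, v \in vs -> enorm v <= 1) ->
  `|dirderiv vs f x - dirderiv vs f y| <= L * enorm (x - y).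
Proof.
move=> fC fL /eqP vsp vs1; apply: le_trans fL.
have [Mx MxP] := dirderiv_bounded x fC.
have [My MyP] := dirderiv_bounded y fC.
apply: ub_le_sup; last first.
  exists (Tuple vsp) => // j; apply: vs1.
  by rewrite (tnth_nth 0) mem_nth// (eqP vsp).
exists (Mx + My) => _ [ws ws1 <-].
have {}ws1 v : v \in tval ws -> enorm v <= 1.
  by move=> /tnthP[j ->]; exact: ws1.
rewrite (le_trans (ler_normB _ _))// lerD//.
  exact: MxP (size_tuple _) ws1.
exact: MyP (size_tuple _) ws1.
Qed.

(** Used with [us] empty, of length 1 and of length 2, for the value, the gradient and the Hessian.
    The expansion stops at total order p, where the Lipschitz condition holds. *)
Lemma dirderiv_taypoly_remainder (R : realType) (n p q : nat)
    (f : 'rV[R]_n -> R) (L : R) (x s : 'rV[R]_n) (us : seq 'rV[R]_n) :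
  p = (q + size us)%N -> 0 <= L -> Ck p f ->
  (forall y : 'rV[R]_n,
    tnorm (fun vs : p.-tuple 'rV[R]_n => nabla f y vs - nabla f x vs)
      <= L * enorm (y - x)) ->
  (forall u, u \in us -> enorm u <= 1) ->
  `|dirderiv us f (x + s) - taypoly q (dirderiv us f) x s|
    <= L * enorm s ^+ q.+1 / (q.+1)`!%:R.
Proof.
move=> pE L0 fC fL us1; subst p; apply: taypoly_remainder.
  by apply: Ck_dirderiv; rewrite addnC.
move=> t /andP[t0 t1].
(* Normalising the q copies of s leaves only directions of norm at most 1, as [tnorm] requires, and
   extracts ||s||^q. *)
have E y : dirderiv (nseq q s) (dirderiv us f) y
    = enorm s ^+ q * dirderiv (nseq q ((enorm s)^-1 *: s) ++ us) f y.
  rewrite -[dirderiv _ (dirderiv _ _)]foldr_cat -/(dirderiv _ _).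
  by rewrite [in LHS](scale_enorm_normalize s) dirderiv_scale// addnC.
rewrite !E -mulrBr normrM normrX (ger0_norm (enorm_ge0 s)).
have := dirderiv_lipschitz fC (fL (x + t *: s))
  (vs := nseq q ((enorm s)^-1 *: s) ++ us).
rewrite size_cat size_nseq => /(_ erefl) H.
rewrite (le_trans (ler_wpM2l _ (H _)))// ?exprn_ge0 ?enorm_ge0//.
  move=> v; rewrite mem_cat => /orP[/nseqP[-> _]|/us1//].
  exact: enorm_normalize_le1.
rewrite addrAC subrr add0r enormZ (ger0_norm t0) exprS.
by rewrite le_eqVlt; apply/orP; left; apply/eqP; ring.
Qed.

(** * Least eigenvalue *)

Lemma edotE (R : realType) (n : nat) (u v : 'rV[R]_n) :
  edot u v = (u *m v^T) 0 0.
Proof. by rewrite mxE; apply: eq_bigr => i _; rewrite mxE. Qed.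

Lemma edot_mulmx (R : realType) (n : nat) (A : 'M[R]_n) (u v : 'rV[R]_n) :
  edot (u *m A) v = edot u (v *m A^T).
Proof. by rewrite !edotE trmx_mul trmxK mulmxA. Qed.

Lemma continuous_quadratic_form (R : realType) (n : nat) (A : 'M[R]_n) :
  continuous (fun v : 'rV[R]_n => edot (v *m A) v).
Proof.
pose c (j : 'I_n) (v : 'rV[R]_n) : R := v 0 j.
have cd j x : differentiable (c j) x by exact: differentiable_coord.
have -> : (fun v : 'rV[R]_n => edot (v *m A) v)
    = \sum_(i < n) ((\sum_(k < n) (A k i \*: c k)) * c i).
  apply/funext => v; rewrite fct_sumE; apply: eq_bigr => i _.
  rewrite mxE -[RHS]/((\sum_(k < n) (A k i \*: c k)) v * c i v) fct_sumE.
  by congr (_ * _); apply: eq_bigr => k _; rewrite mulrC.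
move=> x; apply: differentiable_continuous; apply: differentiable_sum => i.
apply: differentiableM => //; apply: differentiable_sum => k.
exact: differentiableZ.
Qed.

(** Bounded because the sup norm is at most the Euclidean one; closed as a level set of the
    quadratic form of the identity. *)
Lemma compact_unit_sphere (R : realType) (n : nat) :
  compact [set v : 'rV[R]_n | edot v v = 1].
Proof.
apply: bounded_closed_compact.
  exists 1; split=> [|M M1 v /= v1]; first exact: num_real.
  rewrite (le_trans _ (ltW M1))// [leLHS]/Num.Def.normr/= mx_normrE.
  apply/bigmax_leP; split=> // -[i j] _ /=; rewrite (ord1 i).
  by rewrite (le_trans (coord_le_enorm _ _))// enormE v1 sqrtr1.
have := @continuous_quadratic_form R n 1%:M.
under eq_fun do rewrite mulmx1.
by move=> /continuous_closedP/(_ [set 1]); apply; exact: closed_eq.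
Qed.

(** The quadratic form attains its minimum on the compact unit sphere, nonempty as n > 0; the
    minimum is the eigenvalue m and a minimiser is an eigenvector. *)
Lemma min_eigenvector (R : realType) (n : nat) (A : 'M[R]_n) :
  (0 < n)%N -> A^T = A -> exists m (v : 'rV[R]_n),
    [/\ v != 0, v *m A = m *: v
      & forall w, m * edot w w <= edot (w *m A) w].
Proof.
move=> n0 AT; pose q (v : 'rV[R]_n) := edot (v *m A) v.
have [|||v] := @EVT_min_rV R n q [set v : 'rV[R]_n | edot v v = 1].
- exists (delta_mx 0 (Ordinal n0)) => /=; rewrite /edot (bigD1 (Ordinal n0))//=.
  rewrite !mxE !eqxx mulr1 big1 ?addr0// => j jn.
  by rewrite mxE (negbTE jn) andbF mul0r.
- exact: compact_unit_sphere.
- exact/continuous_subspaceT/continuous_quadratic_form.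
rewrite inE => /= v1 vmin; pose m := q v.
have mle w : m * edot w w <= q w.
  have [->|w0] := eqVneq w 0.
    by rewrite /q mul0mx -(scale0r (0 : 'rV[R]_n)) !edotZl !mul0r mulr0.
  rewrite [in leRHS](scale_enorm_normalize w) /q -scalemxAl edotZl edotZr mulrA.
  rewrite -expr2 enorm_sqr mulrC ler_wpM2l ?edotvv_ge0// vmin// inE/=.
  by rewrite -enorm_sqr enorm_normalize// expr1n.
exists m, v; split => //.
  by apply: contra_eq_neq v1 => ->; rewrite -(scale0r (0 : 'rV[R]_n)) edotZl
    mul0r eq_sym oner_eq0.
(* The derivative of q - m |.|^2 at its minimiser v vanishes in the
   direction z. *)
apply/eqP; rewrite -subr_eq0 -enorm_eq0 -sqrf_eq0 enorm_sqr; apply/eqP.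
set z := _ - _; pose a := edot z z; pose b := q z - m * a.
have b0 : 0 <= b by rewrite subr_ge0 mle.
have a0 : 0 <= a := edotvv_ge0 z.
(* The inequality [mle] at v + t z; symmetry of A makes the linear coefficient 2 <z, vA - m v> = 2
   a. *)
have quad t : 0 <= 2 * t * a + t ^+ 2 * b.
  have := mle (v + t *: z); rewrite -subr_ge0 /q mulmxDl -scalemxAl.
  rewrite !edotDl !edotDr !edotZl !edotZr v1.
  rewrite (edot_mulmx A z v) AT (edotC z (v *m A)) (edotC z v).
  rewrite -/(q v) -/m -/(q z) -/a.
  have aE : a = edot (v *m A) z - m * edot v z.
    by rewrite -edotZl -mulN1r -edotZl -edotDl scaleN1r.
  rewrite (_ : 2 * t * a = 2 * t * (edot (v *m A) z - m * edot v z));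
    last by rewrite -aE.
  rewrite /b => H; apply: le_trans H _; rewrite le_eqVlt.
  by apply/orP; left; apply/eqP; ring.
apply/eqP; rewrite eq_le a0 andbT leNgt; apply/negP => apos.
(* At this t the quadratic equals -(a / (b + 1))^2 (b + 2), negative if a > 0; b + 1 instead of b
   avoids division by zero. *)
have := quad (- (a / (b + 1))).
have b1 : 0 < b + 1 by rewrite ltr_wpDl.
rewrite (_ : _ + _ = - (a / (b + 1)) ^+ 2 * (b + 2)); last first.
  by field; rewrite gt_eqF.
rewrite leNgt => /negP; apply.
rewrite mulNr oppr_lt0 mulr_gt0 ?exprn_gt0 ?divr_gt0//.
by rewrite ltr_wpDl.
Qed.

(** The Rayleigh minimum m is an eigenvalue and a lower bound of all eigenvalues, so the infimum is
    at most m. *)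
Lemma lambda_min_le (R : realType) (n : nat) (A : 'M[R]_n) (d : 'rV[R]_n) :
  (0 < n)%N -> A^T = A -> lambda_min A * edot d d <= edot (d *m A) d.
Proof.
move=> n0 AT; have [m [v [v0 vA mle]]] := min_eigenvector n0 AT.
apply: le_trans (mle d); rewrite ler_wpM2r ?edotvv_ge0//.
apply: ge_inf; last first.
  by apply/eigenvalueP; exists v.
exists m => a /= /eigenvalueP[w wA w0]; have := mle w; rewrite wA edotZl.
by rewrite ler_pM2r// -enorm_sqr exprn_gt0// enorm_gt0.
Qed.

Lemma le_lambda_min (R : realType) (n : nat) (A : 'M[R]_n) (c : R) :
  (0 < n)%N -> A^T = A ->
  (forall d, enorm d = 1 -> c <= edot (d *m A) d) -> c <= lambda_min A.
Proof.
move=> n0 AT cle; have [m [v [v0 vA _]]] := min_eigenvector n0 AT.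
apply: lb_le_inf => [|a /= /eigenvalueP[w wA w0]].
  by exists m; apply/eigenvalueP; exists v.
have := cle _ (enorm_normalize w0).
rewrite -scalemxAl wA scalerA mulrC -scalerA edotZl -enorm_sqr.
by rewrite enorm_normalize// expr1n mulr1.
Qed.

(** * Gradient and Hessian as directional derivatives *)

Lemma edot_gradient (R : realType) (n : nat) (f : 'rV[R]_n -> R)
    (u x : 'rV[R]_n) : differentiable f x -> edot u (gradient f x) = 'D_u f x.
Proof.
by move=> fd; rewrite derive_coord//; apply: eq_bigr => i _; rewrite mxE.
Qed.

Lemma trmx_hessian (R : realType) (n : nat) (f : 'rV[R]_n -> R)
    (x : 'rV[R]_n) : Ck 2 f -> (hessian f x)^T = hessian f x.
Proof.
move=> fC; apply/matrixP => i j; rewrite !mxE.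
exact (congr1 (fun g => g x) (derive_comm (delta_mx 0 j) (delta_mx 0 i) fC)).
Qed.

Lemma edot_hessian (R : realType) (n : nat) (f : 'rV[R]_n -> R)
    (d x : 'rV[R]_n) : Ck 2 f ->
  edot (d *m hessian f x) d = 'D_d ('D_d f) x.
Proof.
move=> fC; rewrite edotC derive_coord; last first.
  exact: Ck_differentiable (Ck_derive d fC) x.
rewrite edotC -[X in X *m _]trmxK -[X in _ *m X](trmx_hessian x fC) -trmx_mul.
apply: eq_bigr => i _; rewrite mulrC; congr (_ * _); rewrite !mxE.
have := @dirderiv_derive_coord R n [:: delta_mx 0 i] f d x fC => /= ->.
by apply: eq_bigr => j _; rewrite !mxE mulrC.
Qed.

(** * Accuracy of the Taylor model *)

(** A polynomial in s is smooth: each derivative lowers q until a constant remains. This yields the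
    symmetry of the model's Hessian. *)
Lemma Ck_taypoly (R : realType) (n q k : nat) (h : 'rV[R]_n -> R)
    (x : 'rV[R]_n) : Ck q h -> Ck k (taypoly q h x).
Proof.
have taypoly0 (g : 'rV[R]_n -> R) : taypoly 0 g x = fun _ => g x.
  by apply/funext => s; rewrite /taypoly big_ord1 fact0 invr1 mul1r.
elim: k q h => [|k IH] [|q] h hC.
- by rewrite taypoly0; exact: Ck_cst.
- by move=> s; exact/differentiable_continuous/(taypoly_derive x s hC).1.
- by rewrite taypoly0; exact: Ck_cst.
split=> [s|u]; first exact: (taypoly_derive x s hC).1.
rewrite (_ : 'D_u _ = taypoly q ('D_u h) x); first exact/IH/Ck_derive.
by apply/funext => s; exact: (taypoly_derive x s hC).2.
Qed.

Lemma taylor_upper_bound (R : realType) (n p : nat) (f : 'rV[R]_n -> R) (L : R)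
    (x s : 'rV[R]_n) : 0 <= L -> Ck p f ->
  (forall y : 'rV[R]_n,
    tnorm (fun vs : p.-tuple 'rV[R]_n => nabla f y vs - nabla f x vs)
      <= L * enorm (y - x)) ->
  f (x + s) <= taylor p f x s + L * enorm s ^+ p.+1 / (p.+1)`!%:R.
Proof.
move=> L0 fC fL; rewrite taylorE -lerBlDl (le_trans (ler_norm _))//.
apply: (@dirderiv_taypoly_remainder _ _ p _ _ _ _ _ [::]) => //.
by rewrite addn0.
Qed.

Lemma gradient_taylor_error (R : realType) (n p : nat) (f : 'rV[R]_n -> R)
    (L : R) (x s : 'rV[R]_n) : (0 < p)%N -> 0 <= L -> Ck p f ->
  (forall y : 'rV[R]_n,
    tnorm (fun vs : p.-tuple 'rV[R]_n => nabla f y vs - nabla f x vs)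
      <= L * enorm (y - x)) ->
  enorm (gradient f (x + s) - gradient (taylor p f x) s)
    <= L * enorm s ^+ p / p`!%:R.
Proof.
case: p => [//|q] _ L0 fC fL; apply: enorm_le_edot => [|u u1].
  by rewrite !mulr_ge0// exprn_ge0// enorm_ge0.
rewrite edotDr edotNr edot_gradient; last exact: Ck_differentiable fC _.
have [Td TD] := taypoly_derive x s fC.
rewrite taylorE edot_gradient// TD (le_trans (ler_norm _))//.
apply: (@dirderiv_taypoly_remainder _ _ q.+1 _ _ _ _ _ [:: u]) => //.
  by rewrite addn1.
by move=> v; rewrite inE => /eqP ->.
Qed.

(** For every unit d, the least eigenvalue of the model's Hessian is at most its quadratic form at
    d, which differs from that of f by the Taylor error of D_d D_d f. *)
Lemma lambda_min_hessian_taylor (R : realType) (n p : nat)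
    (f : 'rV[R]_n -> R) (L : R) (x s : 'rV[R]_n) :
  (0 < n)%N -> (1 < p)%N -> 0 <= L -> Ck p f ->
  (forall y : 'rV[R]_n,
    tnorm (fun vs : p.-tuple 'rV[R]_n => nabla f y vs - nabla f x vs)
      <= L * enorm (y - x)) ->
  lambda_min (hessian (taylor p f x) s) - L * enorm s ^+ p.-1 / (p.-1)`!%:R
    <= lambda_min (hessian f (x + s)).
Proof.
case: p => [//|[//|q]] n0 _ L0 fC fL; have fC2 : Ck 2 f by exact: Ck_leq fC.
have TC : Ck 2 (taypoly q.+2 f x) by exact: Ck_taypoly.
rewrite taylorE; apply: le_lambda_min => // [|d d1].
  exact: trmx_hessian.
have TDD : 'D_d ('D_d (taypoly q.+2 f x)) s = taypoly q ('D_d ('D_d f)) x s.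
  have E : 'D_d (taypoly q.+2 f x) = taypoly q.+1 ('D_d f) x.
    by apply/funext => y; exact: (taypoly_derive x y fC).2.
  exact (etrans (congr1 (fun g => 'D_d g s) E)
    ((taypoly_derive x s (Ck_derive d fC)).2 d)).
have lle := lambda_min_le d n0 (trmx_hessian s TC).
rewrite -enorm_sqr d1 expr1n mulr1 (edot_hessian d s TC) TDD in lle.
rewrite (edot_hessian d (x + s) fC2) lerBlDr (le_trans lle)// -lerBlDl.
rewrite (le_trans (ler_norm _))// distrC.
apply: (@dirderiv_taypoly_remainder _ _ q.+2 _ _ _ _ _ [:: d; d]) => //.
  by rewrite addn2.
by move=> v; rewrite !inE orbb => /eqP ->; rewrite d1.
Qed.

(** Cauchy-Schwarz bounds the linear term, and [khigh] at s / ||s|| the others. This is what limits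
    the length of a step that decreases the model. *)
Lemma taylor_lower_bound (R : realType) (n p : nat) (f : 'rV[R]_n -> R)
    (khigh : R) (x s : 'rV[R]_n) : (0 < p)%N -> Ck p f ->
  (forall i d, (2 <= i <= p)%N -> enorm d <= 1 ->
    khigh <= tapp (nabla (i := i) f x) d) ->
  f x - enorm (gradient f x) * enorm s
      + \sum_(2 <= i < p.+1) khigh / i`!%:R * enorm s ^+ i
    <= taylor p f x s.
Proof.
move=> p0 fC fk; rewrite /taylor [in leRHS]big_ltn// -addrA lerD2l.
have fd : differentiable f x.
  by move: p p0 fC {fk} => [//|p] _ fC; exact: Ck_differentiable fC _.
apply: lerD.
  rewrite factS fact0 muln1 invr1 mul1r -[leRHS]/('D_s f x) -edot_gradient//.
  rewrite lerNl -edotNr edotC mulrC edotC.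
  by rewrite (le_trans (edot_le_enorm _ _))// enormN.
apply: ler_sum_nat => i; rewrite ltnS => ip.
rewrite mulrAC mulrC ler_wpM2l ?invr_ge0//.
rewrite -[leRHS]/(dirderiv (nseq i s) f x) -[nseq i s]cats0.
rewrite [in leRHS](scale_enorm_normalize s) dirderiv_scale; last first.
  by apply: Ck_leq fC; rewrite add0n; case/andP: ip.
rewrite mulrC ler_wpM2l ?exprn_ge0 ?enorm_ge0// cats0.
exact: fk ip (enorm_normalize_le1 s).
Qed.

(** * Real inequalities *)

Lemma powR_natdiv (R : realType) (a : R) (m q : nat) : 0 <= a -> (0 < q)%N ->
  (a ^+ q) `^ (m%:R / q%:R) = a ^+ m.
Proof.
move=> a0 q0; rewrite -powR_mulrn// -powRrM mulrCA divff ?mulr1 ?powR_mulrn//.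
by rewrite pnatr_eq0 -lt0n.
Qed.

Lemma powR_root_exp (R : realType) (a : R) (m q : nat) :
  (a `^ (1 / q%:R)) ^+ m = a `^ (m%:R / q%:R).
Proof.
by rewrite -powR_mulrn ?powR_ge0// -powRrM mulrC mulrA mulr1.
Qed.

Lemma powR_rootK (R : realType) (a : R) (q : nat) : 0 <= a -> (0 < q)%N ->
  (a `^ (1 / q%:R)) ^+ q = a.
Proof.
move=> a0 q0; rewrite powR_root_exp divff ?powRr1//.
by rewrite pnatr_eq0 -lt0n.
Qed.

Lemma sum_half_powers (R : realType) (q : nat) :
  \sum_(i < q) (2^-1 : R) ^+ (q - i) = 1 - 2^-1 ^+ q.
Proof.
elim: q => [|q IH]; first by rewrite big_ord0 expr0 subrr.
rewrite big_ord_recl (eq_bigr (fun i : 'I_q => 2^-1 ^+ (q - i))); last first.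
  by move=> i _; rewrite lift0 subSS.
by rewrite IH/= subn0 exprS; field.
Qed.

(* Otherwise M < r / 2, each term on the right of the hypothesis is less than
   r^(p+1) times a power of 1/2, and these powers add up to less than 1. *)
Lemma root_bound (R : realType) (p : nat) (a : nat -> R) (c M r : R) :
  (0 < p)%N -> 0 <= M -> c <= M ^+ p ->
  (forall i, (2 <= i <= p)%N -> a i <= M ^+ (p - i + 1)) ->
  r ^+ p.+1 <= c * r + \sum_(2 <= i < p.+1) a i * r ^+ i -> r <= 2 * M.
Proof.
move=> p0 M0 cM aM rle; rewrite leNgt; apply/negP => Mr.
have r0 : 0 < r by apply: le_lt_trans Mr; rewrite mulr_ge0.
have Mr2 : M <= r * 2^-1 by rewrite ler_pdivlMr// mulrC ltW.
have Mle k : M ^+ k <= r ^+ k * 2^-1 ^+ k.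
  by rewrite -exprMn lerXn2r// nnegrE// mulr_ge0// ?(ltW r0)// invr_ge0.
have rp0 : 0 < r ^+ p.+1 by rewrite exprn_gt0.
suff : r ^+ p.+1 <= r ^+ p.+1 * (1 - 2^-1 ^+ p).
  rewrite leNgt gtr_pMr// => /negP; apply.
  by rewrite ltrBlDr ltrDl exprn_gt0// invr_gt0.
rewrite (le_trans rle)//.
have -> : r ^+ p.+1 * (1 - 2^-1 ^+ p) = r ^+ p.+1 * 2^-1 ^+ p
    + \sum_(2 <= i < p.+1) r ^+ p.+1 * 2^-1 ^+ (p - i + 1).
  case: p p0 {cM aM rle rp0} => [//|p] _.
  rewrite -mulr_sumr -mulrDr; congr (_ * _).
  rewrite big_add1 big_add1 big_mkord/=.
  rewrite (eq_bigr (fun i : 'I_p => 2^-1 ^+ (p - i))).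
    by rewrite sum_half_powers exprS; field.
  by move=> i _; rewrite subSS addn1 subnSK.
apply: lerD.
  rewrite exprSr mulrAC ler_wpM2r ?(ltW r0)//.
  exact: le_trans cM (Mle p).
apply: ler_sum_nat => i; rewrite ltnS => ip.
have -> : r ^+ p.+1 = r ^+ (p - i + 1) * r ^+ i.
  by rewrite -exprD addnAC subnK ?addn1//; case/andP: ip.
rewrite mulrAC ler_wpM2r ?exprn_ge0 ?(ltW r0)//.
exact: le_trans (aM i ip) (Mle _).
Qed.

(** Convexity of powers; the inductive step uses (u - v)(u^(m+1) - v^(m+1)) >= 0. *)
Lemma expD_le (R : realType) (u v : R) (m : nat) : 0 <= u -> 0 <= v ->
  (u + v) ^+ m.+1 <= 2 ^+ m * (u ^+ m.+1 + v ^+ m.+1).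
Proof.
move=> u0 v0; elim: m => [|m IH]; first by rewrite expr0 mul1r !expr1.
rewrite exprS (le_trans (ler_wpM2l _ IH)) ?addr_ge0//.
rewrite [2 ^+ m.+1]exprSr mulrCA -mulrA ler_wpM2l ?exprn_ge0//.
have H : 0 <= (u - v) * (u ^+ m.+1 - v ^+ m.+1).
  have [uv|/ltW vu] := leP v u.
    by rewrite mulr_ge0 ?subr_ge0// lerXn2r.
  by rewrite mulr_le0 ?subr_le0// lerXn2r.
rewrite (exprS u m.+1) (exprS v m.+1); lra.
Qed.

(* In the two uses of this lemma q and q + r are p and p + 1, or p - 1 and
   p + 1. *)
Lemma step_bound (R : realType) (q r : nat) (eps c sigma smax S : R) :
  (0 < q)%N -> 0 < eps -> 0 <= c -> 0 < sigma <= smax -> 0 <= S ->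
  eps <= sigma * c * S ^+ q ->
  1 <= smax `^ (r%:R / q%:R) * c `^ ((q + r)%:R / q%:R)
    * eps `^ (- ((q + r)%:R / q%:R)) * (sigma * S ^+ (q + r)).
Proof.
move=> q0 eps0 c0 /andP[sigma0 sigmale] S0 epsle.
set e := (q + r)%:R / q%:R.
have e0 : 0 <= e by rewrite divr_ge0.
have eE : e = 1 + r%:R / q%:R.
  by rewrite /e natrD mulrDl divff// pnatr_eq0 -lt0n.
have ege0 : 0 < eps `^ e by rewrite powR_gt0.
have : eps `^ e <= (sigma * c * S ^+ q) `^ e.
  by apply: ge0_ler_powR => //; rewrite ?nnegrE ?(ltW eps0)//
    !mulr_ge0 ?(ltW sigma0) ?exprn_ge0.
rewrite !powRM ?mulr_ge0 ?(ltW sigma0) ?exprn_ge0// powR_natdiv//.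
(* Since e = 1 + r/q, one factor sigma stays with S^(q+r) and the power r/q is left to be bounded
   through [smax]. *)
have -> : sigma `^ e = sigma * sigma `^ (r%:R / q%:R).
  by rewrite eE powRD ?powRr1 ?(ltW sigma0)// (gt_eqF sigma0) implybT.
move=> H; rewrite powRN -[leLHS](mulVf (lt0r_neq0 ege0)).
rewrite -mulrA mulrCA ler_wpM2l ?invr_ge0 ?(ltW ege0)//.
apply: le_trans H _.
rewrite (_ : _ * _ * _ * _ = sigma `^ (r%:R / q%:R)
  * (c `^ e * (sigma * S ^+ (q + r)))); last by ring.
rewrite -[leRHS]mulrA ler_wpM2r//.
  by rewrite !mulr_ge0 ?powR_ge0 ?(ltW sigma0) ?exprn_ge0.
by apply: ge0_ler_powR; rewrite ?divr_ge0 ?nnegrE ?(ltW sigma0)//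
  (le_trans (ltW sigma0)).
Qed.

(** * Counting iterations *)

(* What the analysis of one iteration gives, for the iterations 0, ..., K of a
   run: r, g, l and F stand for the norm of the step, the norm of the gradient,
   minus the least eigenvalue of the Hessian, and the objective value. *)
Record moffar_estimates (R : realType) (p K : nat)
    (L khigh flow nu0 theta1 theta2 vtheta : R)
    (r g l F sigma nu : nat -> R) : Prop := MoffarEstimates {
  est_L : 0 <= L;
  est_khigh : khigh <= 0;
  est_nu0 : 0 < nu0;
  est_theta1 : 0 < theta1;
  est_theta2 : 0 < theta2;
  est_vtheta : 0 < vtheta <= 1;
  est_r : forall j, 0 <= r j;
  est_g : forall j, 0 <= g j;
  est_flow : forall j, flow <= F j;
  est_nu_0 : nu 0%N = nu0;
  est_sigma_0 : sigma 0%N = nu0;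
  est_sigma : forall j, (j <= K)%N ->
    vtheta * nu j <= sigma j <= Num.max (nu j) L;
  est_nu_S : forall j, (j <= K)%N -> nu j.+1 = nu j + nu j * r j ^+ p.+1;
  est_decrease : forall j, (j <= K)%N ->
    (sigma j - L) * r j ^+ p.+1 <= (p.+1)`!%:R * (F j - F j.+1);
  est_gradient : forall j, (j <= K)%N ->
    g j.+1 <= (L + theta1 * sigma j) / p`!%:R * r j ^+ p;
  est_eigenvalue : forall j, (j <= K)%N ->
    l j.+1 <= (L + theta2 * sigma j) / (p.-1)`!%:R * r j ^+ p.-1;
  est_model : forall j, (j <= K)%N ->
    sigma j / (p.+1)`!%:R * r j ^+ p.+1
      <= g j * r j + \sum_(2 <= i < p.+1) (- khigh) / i`!%:R * r j ^+ i }.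

Lemma nu_ge (R : realType) (p K : nat)
    (L khigh flow nu0 theta1 theta2 vtheta : R)
    (r g l F sigma nu : nat -> R) (j : nat) :
  moffar_estimates p K L khigh flow nu0 theta1 theta2 vtheta r g l F sigma nu ->
  (j <= K.+1)%N -> nu0 <= nu j.
Proof.
move=> E; elim: j => [_|j IH jK]; first by rewrite (est_nu_0 E).
have n0 := IH (ltnW jK); rewrite (est_nu_S E)// (le_trans n0)// lerDl.
by rewrite mulr_ge0 ?exprn_ge0 ?(est_r E)// (le_trans (ltW (est_nu0 E))).
Qed.

Lemma sigma_gt0 (R : realType) (p K : nat)
    (L khigh flow nu0 theta1 theta2 vtheta : R)
    (r g l F sigma nu : nat -> R) (j : nat) :
  moffar_estimates p K L khigh flow nu0 theta1 theta2 vtheta r g l F sigma nu ->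
  (j <= K)%N -> 0 < vtheta * nu0 <= sigma j.
Proof.
move=> E jK; have /andP[v0 _] := est_vtheta E.
rewrite mulr_gt0 ?(est_nu0 E)//=; have /andP[+ _] := est_sigma E jK.
by apply: le_trans; rewrite ler_pM2l// (nu_ge E)// leqW.
Qed.

Lemma eta_ge0 (R : realType) (p : nat) (khigh vtheta nu0 : R) :
  0 <= Defs.eta p khigh vtheta nu0.
Proof. by apply: sumr_ge0 => i _; exact: powR_ge0. Qed.

(** Multiplying [est_model] by (p+1)!/sigma_j gives a polynomial inequality in r_j, to which
    [root_bound] applies with M the sum of [eta] and the root of the linear coefficient. *)
Lemma step_norm_bound (R : realType) (p K : nat)
    (L khigh flow nu0 theta1 theta2 vtheta : R)
    (r g l F sigma nu : nat -> R) (j : nat) :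
  moffar_estimates p K L khigh flow nu0 theta1 theta2 vtheta r g l F sigma nu ->
  (0 < p)%N -> (j <= K)%N ->
  r j <= 2 * Defs.eta p khigh vtheta nu0
    + 2 * ((p.+1)`!%:R * g j / sigma j) `^ (1 / p%:R).
Proof.
move=> E p0 jK; have /andP[vn sj] := sigma_gt0 E jK.
have /andP[vt0 _] := est_vtheta E.
have s0 : 0 < sigma j by exact: lt_le_trans sj.
have f0 i : 0 < i`!%:R :> R by rewrite ltr0n fact_gt0.
have x0 : 0 <= (p.+1)`!%:R * g j / sigma j.
  by rewrite divr_ge0 ?mulr_ge0 ?(est_g E)// ltW.
have k0 : 0 <= - khigh by rewrite oppr_ge0 (est_khigh E).
have eta0 := eta_ge0 p khigh vtheta nu0.
rewrite -mulrDr; apply: (@root_bound _ p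
  (fun i => (- khigh * (p.+1)`!%:R) / (i`!%:R * sigma j))
  ((p.+1)`!%:R * g j / sigma j)) => //.
- by rewrite addr_ge0 ?powR_ge0.
- rewrite -[leLHS](powR_rootK x0 p0) lerXn2r ?nnegrE ?addr_ge0 ?powR_ge0//.
  by rewrite lerDr.
(* [B] has vtheta nu0 in place of the larger sigma_j; its root is one of the summands of [eta]. *)
- move=> i ip; pose B : R :=
    Num.max 0 (- khigh) * (p.+1)`!%:R / (i`!%:R * vtheta * nu0).
  have B0 : 0 <= B.
    by rewrite /B max_r// divr_ge0 ?mulr_ge0 ?(ltW (est_nu0 E)) ?(ltW vt0)//.
  have Beta : B `^ (1 / (p - i + 1)%:R) <= Defs.eta p khigh vtheta nu0.
    rewrite /Defs.eta (bigD1_seq i) ?iota_uniq ?mem_index_iota//= lerDl.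
    by apply: sumr_ge0 => ? _; exact: powR_ge0.
  apply: (@le_trans _ _ B).
    rewrite /B max_r// ler_wpM2l ?mulr_ge0//.
    by rewrite lef_pV2 ?posrE ?mulr_gt0 ?(est_nu0 E)// -mulrA ler_pM2l.
  rewrite -[leLHS](@powR_rootK _ _ (p - i + 1)) ?addn1// -addn1.
  rewrite lerXn2r ?nnegrE ?addr_ge0 ?powR_ge0// (le_trans Beta)//.
  by rewrite lerDl powR_ge0.
have := est_model E jK; rewrite -(ler_pM2l (divr_gt0 (f0 p.+1) s0)).
rewrite mulrDr mulr_sumr => H.
rewrite (_ : r j ^+ p.+1 = (p.+1)`!%:R / sigma j
  * (sigma j / (p.+1)`!%:R * r j ^+ p.+1)); last first.
  by field; rewrite fact_neq0 gt_eqF.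
apply: le_trans H _; apply: lerD; first by rewrite mulrA (mulrAC _ _ (g j)).
rewrite le_eqVlt; apply/orP; left; apply/eqP; apply: eq_bigr => i _.
by field; rewrite fact_neq0 gt_eqF.
Qed.

Lemma kappa1_ge1 (R : realType) (p : nat)
    (Lp khigh theta1 vtheta nu0 sigma0 : R) :
  1 <= kappa1 p Lp khigh theta1 vtheta nu0 sigma0.
Proof.
rewrite /kappa1 -addrA lerDl addr_ge0// mulr_ge0 ?exprn_ge0 ?eta_ge0//.
exact: powR_ge0.
Qed.

(** The length of step j+1 is controlled by [eta] and g_{j+1}, and g_{j+1} by r_j^p. A large r_j is
    harmless because it has already made nu_{j+1} large relative to nu_j. *)
Lemma nu_growth (R : realType) (p K : nat)
    (L khigh flow nu0 theta1 theta2 vtheta : R)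
    (r g l F sigma nu : nat -> R) (j : nat) :
  moffar_estimates p K L khigh flow nu0 theta1 theta2 vtheta r g l F sigma nu ->
  (0 < p)%N -> (j < K)%N ->
  nu j.+2 <= kappa1 p L khigh theta1 vtheta nu0 nu0 * nu j.+1.
Proof.
move=> E p0 jK; have /andP[vt0 _] := est_vtheta E; have n0 := est_nu0 E.
have t0 := est_theta1 E; have L0 := est_L E.
have /andP[_ sj] := sigma_gt0 E jK.
have s0 : 0 < sigma j.+1 by apply: lt_le_trans sj; rewrite mulr_gt0.
have nj : nu0 <= nu j by apply: nu_ge E _; exact/ltnW/ltnW.
have nj1 : nu0 <= nu j.+1 by apply: nu_ge E _; exact/ltnW.
have nj0 : 0 < nu j := lt_le_trans n0 nj.
have nj10 : 0 < nu j.+1 := lt_le_trans n0 nj1.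
rewrite (est_nu_S E)// -[X in X + _]mulr1 -mulrDr mulrC ler_pM2r//.
rewrite /kappa1 -addrA lerD2l -mulrDr.
set e := Defs.eta _ _ _ _; set C := _ `^ _.
have e0 : 0 <= e := eta_ge0 _ _ _ _.
pose b := ((p.+1)`!%:R * g j.+1 / sigma j.+1) `^ (1 / p%:R).
have b0 : 0 <= b := powR_ge0 _ _.
have rle : r j.+1 <= 2 * e + 2 * b := step_norm_bound E p0 jK.
apply: (@le_trans _ _ ((2 * e + 2 * b) ^+ p.+1)).
  by rewrite lerXn2r ?nnegrE ?(est_r E)// addr_ge0 ?mulr_ge0.
rewrite (le_trans (expD_le _ _ _)) ?mulr_ge0//.
rewrite !exprMn -mulrDr mulrA -exprD addnS addnn -mul2n addn1.
rewrite ler_wpM2l ?exprn_ge0// lerD2l.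
pose W := p.+1%:R / vtheta * ((1 + theta1) * (L / nu0) + theta1).
have W0 : 0 <= W.
  rewrite mulr_ge0 ?divr_ge0 ?(ltW vt0)// addr_ge0 ?(ltW t0)//.
  by rewrite mulr_ge0 ?addr_ge0 ?divr_ge0 ?(ltW t0) ?(ltW n0).
(* nu_j comes from the gradient estimate and nu_{j+1} from sigma_{j+1} >= vtheta nu_{j+1}. In the
   end rho r_j^(p+1) <= 1, by the update of nu. *)
pose rho := nu j / nu j.+1.
have rho0 : 0 <= rho by rewrite divr_ge0 ?ltW.
have rho_le1 : rho <= 1.
  rewrite /rho ler_pdivrMr// mul1r (est_nu_S E (ltnW jK)) lerDl.
  by rewrite mulr_ge0 ?(ltW nj0)// exprn_ge0 ?(est_r E).
have xle : (p.+1)`!%:R * g j.+1 / sigma j.+1 <= rho * (W * r j ^+ p).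
  have jK' := ltnW jK.
  have rp0 : 0 <= r j ^+ p by rewrite exprn_ge0 ?(est_r E).
  (* Source of the bracket in [kappa1]: sigma_j <= nu_j + L, and L <= nu_j L / nu0 because nu_j >=
     nu0. *)
  have Q : L + theta1 * sigma j
      <= nu j * ((1 + theta1) * (L / nu0) + theta1).
    have sle : sigma j <= nu j + L.
      have /andP[_] := est_sigma E jK'; rewrite le_max => /orP[|] H.
        by rewrite (le_trans H)// lerDl.
      by rewrite (le_trans H)// lerDr ltW.
    have Lle : L <= nu j * (L / nu0).
      by rewrite mulrA ler_pdivlMr// mulrC ler_wpM2r.
    have : theta1 * sigma j <= theta1 * (nu j + L) by rewrite ler_pM2l.
    have : theta1 * L <= theta1 * (nu j * (L / nu0)) by rewrite ler_pM2l.
    lra.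
  have vn : vtheta * nu j.+1 <= sigma j.+1.
    by have /andP[] := est_sigma E jK.
  rewrite ler_pdivrMr// factS natrM.
  apply: (@le_trans _ _ (p.+1%:R * ((L + theta1 * sigma j) * r j ^+ p))).
    rewrite -mulrA ler_wpM2l// mulrC -ler_pdivlMr ?ltr0n ?fact_gt0// mulrAC.
    exact: (est_gradient E jK').
  apply: (@le_trans _ _ (p.+1%:R
      * (nu j * ((1 + theta1) * (L / nu0) + theta1) * r j ^+ p))).
    by rewrite ler_wpM2l// ler_wpM2r.
  rewrite (_ : p.+1%:R * _ = rho * (W * r j ^+ p) * (vtheta * nu j.+1)).
    by rewrite ler_wpM2l// mulr_ge0// mulr_ge0.
  by rewrite /rho /W; field; rewrite !gt_eqF.
have x0 : 0 <= (p.+1)`!%:R * g j.+1 / sigma j.+1.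
  by rewrite divr_ge0 ?mulr_ge0 ?(est_g E)// ltW.
rewrite /b powR_root_exp.
have a1 : 1 <= p.+1%:R / p%:R :> R.
  by rewrite ler_pdivlMr ?ltr0n// mul1r ler_nat.
have Wr0 : 0 <= W * r j ^+ p by rewrite mulr_ge0 ?exprn_ge0 ?(est_r E).
apply: (@le_trans _ _ ((rho * (W * r j ^+ p)) `^ (p.+1%:R / p%:R))).
  by apply: ge0_ler_powR; rewrite ?nnegrE//; exact: mulr_ge0.
rewrite powRM// [(W * _) `^ _]powRM ?exprn_ge0 ?(est_r E)//.
rewrite powR_natdiv ?(est_r E)// -/C mulrCA -[leRHS]mulr1.
rewrite ler_wpM2l ?powR_ge0//.
(* As 0 <= rho <= 1 and (p+1)/p >= 1, raising rho to this power does not increase it. *)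
apply: (@le_trans _ _ (rho * r j ^+ p.+1)).
  rewrite ler_wpM2r ?exprn_ge0 ?(est_r E)//.
  have [->|rhoN0] := eqVneq rho 0.
    by rewrite powR0// gt_eqF// (lt_le_trans ltr01).
  by apply: ge1r_powR => //; rewrite rho_le1 andbT lt_neqAle eq_sym rhoN0.
rewrite /rho mulrAC ler_pdivrMr// mul1r (est_nu_S E (ltnW jK)) lerDr.
exact: ltW.
Qed.

(** For j <= 1 the bound comes from the initial gradient, as no step precedes step 0. For j >= 2,
    nu_j <= kappa_1 nu_{j-1} with nu_{j-1} still below the threshold. *)
Lemma nu_le_nu_max (R : realType) (p K : nat)
    (L khigh flow nu0 theta1 theta2 vtheta : R)
    (r g l F sigma nu : nat -> R) (j : nat) :
  moffar_estimates p K L khigh flow nu0 theta1 theta2 vtheta r g l F sigma nu ->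
  (0 < p)%N -> (j <= K.+1)%N ->
  (forall i, (i < j)%N -> nu i < 2 * L / vtheta) ->
  nu j <= nu_max p (g 0%N) L khigh theta1 vtheta nu0 nu0.
Proof.
move=> E p0 jK small; have n0 := est_nu0 E.
have e0 := eta_ge0 p khigh vtheta nu0.
have /andP[vt0 _] := est_vtheta E.
rewrite /nu_max le_max; case: j jK small => [|[|j]] jK small.
- apply/orP; left; rewrite (est_nu_0 E) lerDl mulr_ge0 ?(ltW n0)// exprn_ge0//.
  by rewrite addr_ge0// mulr_ge0// powR_ge0.
- apply/orP; left; rewrite (est_nu_S E)// (est_nu_0 E) lerD2l ler_pM2l//.
  rewrite lerXn2r ?nnegrE ?(est_r E)//.
    by rewrite addr_ge0// mulr_ge0// powR_ge0.
  by have := step_norm_bound E p0 (leq0n K); rewrite (est_sigma_0 E).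
apply/orP; right; rewrite (le_trans (nu_growth E p0 _))//.
rewrite (_ : 2 * _ * L / vtheta = kappa1 p L khigh theta1 vtheta nu0 nu0
  * (2 * L / vtheta)); last by rewrite mulrA [2 * _]mulrC -!mulrA.
rewrite ler_wpM2l ?ltW ?small//.
exact: lt_le_trans ltr01 (kappa1_ge1 _ _ _ _ _ _ _).
Qed.

(** * Total weighted step length *)

Lemma energy_bound (R : realType) (p K : nat)
    (L khigh flow nu0 theta1 theta2 vtheta : R)
    (r g l F sigma nu : nat -> R) (m : nat) :
  moffar_estimates p K L khigh flow nu0 theta1 theta2 vtheta r g l F sigma nu ->
  (0 < p)%N -> (m <= K.+1)%N ->
  \sum_(i < m) sigma i / 2 * r i ^+ p.+1
    <= (p.+1)`!%:R * (F 0%N - F m)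
       + L / nu0 * nu_max p (g 0%N) L khigh theta1 vtheta nu0 nu0.
Proof.
move=> E p0 mK; set N := nu_max _ _ _ _ _ _ _ _.
have n0 := est_nu0 E; have L0 := est_L E.
have /andP[vt0 _] := est_vtheta E.
have Ln0 : 0 <= L / nu0 by rewrite divr_ge0 ?(ltW n0).
(* [z] follows nu_m up to the first index where nu reaches the threshold, and is frozen from then
   on. *)
suff [z zN [+ _]] : exists2 z, z <= N &
    \sum_(i < m) sigma i / 2 * r i ^+ p.+1
      <= (p.+1)`!%:R * (F 0%N - F m) + L / nu0 * (z - nu0) /\
    ((z = nu m /\ forall i, (i < m)%N -> nu i < 2 * L / vtheta)
     \/ 2 * L / vtheta <= nu m).
  move=> H; rewrite (le_trans H)// lerD2l ler_wpM2l// lerBlDr (le_trans zN)//.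
  by rewrite lerDl ltW.
elim: m mK => [_|m IH mK].
  exists nu0.
    have : nu 0%N <= N by apply: nu_le_nu_max E p0 (leq0n _) _.
    by rewrite (est_nu_0 E).
  rewrite big_ord0 !subrr !mulr0 addr0; split=> //; left; split=> //.
  by rewrite (est_nu_0 E).
have [z zN [IHm zP]] := IH (ltnW mK).
have dec := est_decrease E mK.
have rp0 : 0 <= r m ^+ p.+1 by rewrite exprn_ge0 ?(est_r E).
have nm : nu0 <= nu m by apply: nu_ge E _; exact: ltnW.
have nS : nu m <= nu m.+1.
  by rewrite (est_nu_S E)// lerDl mulr_ge0// (le_trans (ltW n0)).
have /andP[svn _] := est_sigma E mK.
have s0 : 0 <= sigma m.
  by apply: le_trans svn; rewrite mulr_ge0 ?(ltW vt0)// (le_trans (ltW n0)).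
have [big|small] := leP (2 * L / vtheta) (nu m).
  (* Past the threshold L <= vtheta nu_m / 2 <= sigma_m / 2, so the decrease of F alone pays for the
     new term. *)
  exists z => //; split; last by right; exact: le_trans big nS.
  have : (sigma m / 2) * r m ^+ p.+1 <= (sigma m - L) * r m ^+ p.+1.
    rewrite ler_wpM2r// lerBrDr -lerBrDl.
    move: big; rewrite ler_pdivrMr// mulrC [nu m * _]mulrC => big; lra.
  rewrite big_ord_recr/=; lra.
case: zP => [[zE zsmall]|]; last by rewrite leNgt small.
have small' i : (i < m.+1)%N -> nu i < 2 * L / vtheta.
  by rewrite ltnS leq_eqVlt => /predU1P[->//|]; exact: zsmall.
(* Below the threshold L r_m^(p+1) <= (L / nu0)(nu_{m+1} - nu_m), which telescopes into the term in
   [z]. *)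
exists (nu m.+1); first exact: nu_le_nu_max E p0 mK small'.
split; last by left.
rewrite big_ord_recr/= (est_nu_S E)//; rewrite zE in IHm.
have : L * r m ^+ p.+1 <= L / nu0 * (nu m * r m ^+ p.+1).
  by rewrite mulrA ler_wpM2r// mulrAC ler_pdivlMr// ler_wpM2l.
have : 0 <= sigma m * r m ^+ p.+1 by rewrite mulr_ge0.
lra.
Qed.

Lemma energy_total_gap (R : realType) (p K : nat)
    (L khigh flow nu0 theta1 theta2 vtheta : R)
    (r g l F sigma nu : nat -> R) (m : nat) :
  moffar_estimates p K L khigh flow nu0 theta1 theta2 vtheta r g l F sigma nu ->
  (0 < p)%N -> (m <= K.+1)%N ->
  \sum_(i < m) sigma i / 2 * r i ^+ p.+1
    <= (p.+1)`!%:R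
       * total_gap p (F 0%N - flow) (g 0%N) L khigh theta1 vtheta nu0 nu0.
Proof.
move=> E p0 mK; rewrite (le_trans (energy_bound E p0 mK))// /total_gap.
rewrite [leRHS]mulrDr [X in _ <= _ + X]mulrA div1r divff ?fact_neq0// mul1r.
have /andP[vt0 _] := est_vtheta E.
have : 0 <= vtheta * nu0 by rewrite mulr_ge0 ?ltW// (est_nu0 E).
have : (p.+1)`!%:R * (F 0%N - F m) <= (p.+1)`!%:R * (F 0%N - flow) :> R.
  by rewrite ler_wpM2l// lerD2l lerN2 (est_flow E).
lra.
Qed.

Lemma nu0_le_nu_max (R : realType) (p : nat)
    (normg0 L khigh theta1 vtheta nu0 : R) : 0 < nu0 ->
  nu0 <= nu_max p normg0 L khigh theta1 vtheta nu0 nu0.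
Proof.
move=> n0; rewrite le_max; apply/orP; left; rewrite lerDl mulr_ge0 ?(ltW n0)//.
rewrite exprn_ge0// addr_ge0// mulr_ge0 ?powR_ge0//; exact: eta_ge0.
Qed.

(** Since sigma_i >= vtheta nu_i, each increment of nu, times vtheta / 2, is at most a term of the
    energy sum; telescoping bounds nu_j. *)
Lemma sigma_le_sigma_max (R : realType) (p K : nat)
    (L khigh flow nu0 theta1 theta2 vtheta : R)
    (r g l F sigma nu : nat -> R) (j : nat) :
  moffar_estimates p K L khigh flow nu0 theta1 theta2 vtheta r g l F sigma nu ->
  (0 < p)%N -> (j <= K)%N ->
  sigma j <= sigma_max p (F 0%N - flow) (g 0%N) L khigh theta1 vtheta nu0 nu0.
Proof.
move=> E p0 jK; have /andP[vt0 _] := est_vtheta E; have n0 := est_nu0 E.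
have /andP[_ /le_trans] := est_sigma E jK; apply.
rewrite ge_max; apply/andP; split; rewrite /sigma_max; last first.
  by rewrite !le_max lexx orbT.
rewrite le_max; apply/orP; left; set tg := total_gap _ _ _ _ _ _ _ _ _.
have : vtheta / 2 * (nu j - nu0) <= \sum_(i < j) sigma i / 2 * r i ^+ p.+1.
  elim: j jK => [|j IH] jK; first by rewrite big_ord0 (est_nu_0 E) subrr mulr0.
  rewrite big_ord_recr/= (est_nu_S E (ltnW jK)) addrAC mulrDr.
  rewrite lerD ?IH ?(ltnW jK)// mulrA ler_wpM2r ?exprn_ge0 ?(est_r E)//.
  by have /andP[] := est_sigma E (ltnW jK); lra.
have := energy_total_gap E p0 (leqW jK); rewrite -/tg => H1 H2.
have {}H1 := le_trans H2 H1.
have := nu0_le_nu_max p (g 0%N) L khigh theta1 vtheta n0.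
suff : nu j - nu0 <= 2 * (p.+1)`!%:R / vtheta * tg by lra.
rewrite -(ler_pM2l (_ : 0 < vtheta / 2)) ?divr_gt0// (le_trans H1)//.
by rewrite le_eqVlt; apply/orP; left; apply/eqP; field; rewrite gt_eqF.
Qed.

Lemma iteration_count (R : realType) (p K : nat)
    (L khigh flow nu0 theta1 theta2 vtheta eps1 eps2 : R)
    (r g l F sigma nu : nat -> R) :
  moffar_estimates p K L khigh flow nu0 theta1 theta2 vtheta r g l F sigma nu ->
  (1 < p)%N -> 0 < eps1 -> 0 < eps2 ->
  (forall j, (j < K)%N -> eps1 < g j.+1 \/ eps2 < l j.+1) ->
  K%:R <= kappa_moffar p (F 0%N - flow) (g 0%N) L khigh theta1 theta2 vtheta
            nu0 nu0
    * total_gap p (F 0%N - flow) (g 0%N) L khigh theta1 vtheta nu0 nu0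
    * Num.max (eps1 `^ (- (p.+1%:R / p%:R))) (eps2 `^ (- (p.+1%:R / p.-1%:R))).
Proof.
move=> E p1 eps10 eps20 nonterm; have p0 : (0 < p)%N := ltnW p1.
have pp0 : (0 < p.-1)%N by rewrite -subn1 subn_gt0.
have /andP[vt0 _] := est_vtheta E; have n0 := est_nu0 E.
have L0 := est_L E.
have f0 i : 0 < i`!%:R :> R by rewrite ltr0n fact_gt0.
rewrite /kappa_moffar; set tg := total_gap _ _ _ _ _ _ _ _ _.
set smax := sigma_max _ _ _ _ _ _ _ _ _; set Me := Num.max (_ `^ _) (_ `^ _).
set Mk := Num.max _ _.
have Mk0 : 0 <= Mk by rewrite le_max mulr_ge0 ?powR_ge0.
have Me0 : 0 <= Me by rewrite le_max powR_ge0.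
(* L is absorbed into sigma_j through sigma_j >= vtheta nu0, so the estimates take the form sigma c
   r^q expected by [step_bound]. *)
have csigma theta j q : 0 < theta -> (j <= K)%N ->
    (L + theta * sigma j) / q`!%:R
      <= sigma j * ((L / nu0 + vtheta * theta) / (vtheta * q`!%:R)).
  move=> theta0 jK; have /andP[_ sj] := sigma_gt0 E jK.
  have : L * (vtheta * nu0) <= L * sigma j by rewrite ler_wpM2l.
  rewrite ler_pdivrMr// => H.
  rewrite [leRHS](_ : _ = L * sigma j / (vtheta * nu0) + theta * sigma j).
    by rewrite lerD2r ler_pdivlMr// mulr_gt0.
  by field; rewrite fact_neq0 !gt_eqF.
have step j : (j < K)%N -> 1 <= Mk * Me * (sigma j * r j ^+ p.+1).
  move=> jK; have jK' := ltnW jK.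
  have smaxP : 0 < sigma j <= smax.
    rewrite (sigma_le_sigma_max E p0 jK') andbT.
    have /andP[vn] := sigma_gt0 E jK'; exact: lt_le_trans.
  have s0 : 0 <= sigma j by case/andP: smaxP => /ltW.
  (* [a] and [b] are the branches of the two maxima that belong to the failing test, gradient or
     curvature. *)
  have final a b : 0 <= a -> 0 <= b -> a <= Mk -> b <= Me ->
      1 <= a * b * (sigma j * r j ^+ p.+1) ->
      1 <= Mk * Me * (sigma j * r j ^+ p.+1).
    move=> a0 b0 aM bM /le_trans; apply.
    rewrite ler_wpM2r ?mulr_ge0 ?exprn_ge0 ?(est_r E)//.
    exact: ler_pM.
  have c0 theta q : 0 < theta ->
      0 <= (L / nu0 + vtheta * theta) / (vtheta * q`!%:R).
    move=> /ltW t0; rewrite divr_ge0 ?mulr_ge0 ?(ltW vt0)//.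
    by rewrite addr_ge0 ?divr_ge0 ?mulr_ge0 ?(ltW vt0) ?(ltW n0).
  have [epsg|epsl] := nonterm j jK.
  - have H : eps1 <= sigma j
        * ((L / nu0 + vtheta * theta1) / (vtheta * p`!%:R)) * r j ^+ p.
      rewrite (le_trans (ltW epsg))// (le_trans (est_gradient E jK'))//.
      by rewrite ler_wpM2r ?exprn_ge0 ?(est_r E)// csigma// (est_theta1 E).
    have := step_bound 1 p0 eps10 (c0 theta1 p (est_theta1 E)) smaxP
      (est_r E j) H.
    rewrite !addn1; apply: final; rewrite ?mulr_ge0 ?powR_ge0 ?le_max ?lexx//.
  - have H : eps2 <= sigma j
        * ((L / nu0 + vtheta * theta2) / (vtheta * (p.-1)`!%:R))
        * r j ^+ p.-1.
      rewrite (le_trans (ltW epsl))// (le_trans (est_eigenvalue E jK'))//.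
      by rewrite ler_wpM2r ?exprn_ge0 ?(est_r E)// csigma// (est_theta2 E).
    have := step_bound 2 pp0 eps20 (c0 theta2 p.-1 (est_theta2 E)) smaxP
      (est_r E j) H.
    rewrite (_ : (p.-1 + 2)%N = p.+1); last by rewrite addn2 prednK.
    by apply: final; rewrite ?mulr_ge0 ?powR_ge0 ?le_max ?lexx ?orbT.
have : \sum_(j < K) (1 : R)
    <= \sum_(j < K) 2 * (Mk * Me) * (sigma j / 2 * r j ^+ p.+1).
  apply: ler_sum => j _; rewrite (le_trans (step j (ltn_ord j)))//.
  by rewrite le_eqVlt; apply/orP; left; apply/eqP; field.
rewrite sumr_const card_ord -mulr_sumr => H; apply: le_trans H _.
have := energy_total_gap E p0 (leqnSn K); rewrite -/tg => H.
rewrite (le_trans (ler_wpM2l _ H)) ?mulr_ge0//.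
by rewrite le_eqVlt; apply/orP; left; apply/eqP; ring.
Qed.

Lemma kappa_moffar_ge0 (R : realType) (p : nat)
    (gap normg0 L khigh theta1 theta2 vtheta nu0 sigma0 : R) :
  0 <= kappa_moffar p gap normg0 L khigh theta1 theta2 vtheta nu0 sigma0.
Proof.
by rewrite mulr_ge0 ?mulr_ge0// le_max mulr_ge0 ?powR_ge0.
Qed.

Lemma total_gap_ge0 (R : realType) (p : nat)
    (gap normg0 L khigh theta1 vtheta nu0 : R) :
  0 <= gap -> 0 <= L -> 0 < nu0 -> 0 < vtheta ->
  0 <= total_gap p gap normg0 L khigh theta1 vtheta nu0 nu0.
Proof.
move=> gap0 L0 n0 vt0; rewrite addr_ge0// mulr_ge0 ?divr_ge0//.
rewrite addr_ge0 ?mulr_ge0 ?divr_ge0 ?invr_ge0 ?(ltW n0) ?(ltW vt0)//.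
exact: le_trans (ltW n0) (nu0_le_nu_max _ _ _ _ _ _ n0).
Qed.

(** * Runs of the algorithm *)

Lemma taylor0 (R : realType) (n p : nat) (f : 'rV[R]_n -> R) (x : 'rV[R]_n) :
  taylor p f x 0 = f x.
Proof.
rewrite taylorE /taypoly big_ord_recl big1 ?addr0 => [|i _].
  by rewrite fact0 invr1 mul1r.
by rewrite lift0 -[dirderiv _ _ _]/('D_0 (dirderiv (nseq i 0) f) x) derive0
  mulr0.
Qed.

(** Decrease of the model forces s != 0. Combined with the upper Taylor bound it gives decrease of
    f; with the lower one, the inequality limiting ||s||. *)
Lemma step_conditions_estimates (R : realType) (n p : nat)
    (f : 'rV[R]_n -> R) (L khigh theta1 theta2 sigma : R) (x s : 'rV[R]_n) :
  (0 < n)%N -> (1 < p)%N -> 0 <= L -> Ck p f ->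
  (forall y : 'rV[R]_n,
    tnorm (fun vs : p.-tuple 'rV[R]_n => nabla f y vs - nabla f x vs)
      <= L * enorm (y - x)) ->
  (forall i d, (2 <= i <= p)%N -> enorm d <= 1 ->
    khigh <= tapp (nabla (i := i) f x) d) ->
  step_conditions p f theta1 theta2 x sigma s ->
  [/\ 0 < enorm s,
      (sigma - L) * enorm s ^+ p.+1 <= (p.+1)`!%:R * (f x - f (x + s)),
      enorm (gradient f (x + s))
        <= (L + theta1 * sigma) / p`!%:R * enorm s ^+ p,
      - lambda_min (hessian f (x + s))
        <= (L + theta2 * sigma) / (p.-1)`!%:R * enorm s ^+ p.-1
    & sigma / (p.+1)`!%:R * enorm s ^+ p.+1
        <= enorm (gradient f x) * enorm s
           + \sum_(2 <= i < p.+1) (- khigh) / i`!%:R * enorm s ^+ i].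
Proof.
move=> n0 p1 L0 fC fL fk [decrease grad_le eig_ge]; have p0 := ltnW p1.
have s0 : 0 < enorm s.
  by rewrite enorm_gt0; apply/eqP => s0; move: decrease; rewrite s0 subrr ltxx.
have {decrease} : taylor p f x s + sigma / (p.+1)`!%:R * enorm s ^+ p.+1 < f x.
  by move: decrease; rewrite /model taylor0 enorm0 expr0n mulr0 addr0 subr_lt0.
move=> decrease; split=> //.
- have := taylor_upper_bound s L0 fC fL; move: decrease.
  have f0 : 0 < (p.+1)`!%:R :> R by rewrite ltr0n fact_gt0.
  rewrite -(ler_pM2l f0) -(ltr_pM2l f0) !mulrDr mulrBl.
  rewrite [_ * (sigma / _ * _)]mulrA [_ * (sigma / _)]mulrCA divff ?gt_eqF//.
  rewrite [_ * (_ / _)]mulrCA divff ?gt_eqF// !mulr1.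
  by rewrite mulrN; lra.
- have := gradient_taylor_error s p0 L0 fC fL => err.
  rewrite -[X in enorm X](subrK (gradient (taylor p f x) s)).
  rewrite (le_trans (enormD_le _ _))// (le_trans (lerD err grad_le))//.
  by rewrite le_eqVlt; apply/orP; left; apply/eqP; ring.
- have := lambda_min_hessian_taylor s n0 p1 L0 fC fL.
  rewrite lerNl => H; apply: le_trans H.
  rewrite lerBrDr (le_trans _ eig_ge)//.
  by rewrite le_eqVlt; apply/orP; left; apply/eqP; ring.
have := taylor_lower_bound s p0 fC fk.
rewrite (eq_bigr (fun i => - (- khigh / i`!%:R * enorm s ^+ i))).
  by rewrite sumrN; lra.
by move=> i _; rewrite !mulNr opprK.
Qed.

(** The main point is sigma_j <= max(nu_j, L): by the estimates at step j-1, subtracting theta_i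
    sigma_{j-1} leaves [mu1] and [mu2] at most L. *)
Lemma run_estimates (R : realType) (n p : nat) (f : 'rV[R]_n -> R)
    (flow L khigh : R) (x0 : 'rV[R]_n)
    (nu0 eps1 eps2 theta1 theta2 vtheta : R)
    (x s : nat -> 'rV[R]_n) (sigma nu : nat -> R) (K : nat) :
  (0 < n)%N -> (1 < p)%N -> Ck p f -> (forall y, flow <= f y) -> 0 <= L ->
  (forall y z : 'rV[R]_n,
    tnorm (fun vs : p.-tuple 'rV[R]_n => nabla f y vs - nabla f z vs)
      <= L * enorm (y - z)) ->
  khigh <= 0 ->
  (forall i y d, (2 <= i <= p)%N -> enorm d <= 1 ->
    khigh <= tapp (nabla (i := i) f y) d) ->
  0 < nu0 -> 1 < theta1 -> 1 < theta2 -> 0 < vtheta <= 1 ->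
  moffar_run p f x0 nu0 eps1 eps2 theta1 theta2 vtheta x s sigma nu ->
  (forall j, (j <= K)%N -> ~ second_order_point f eps1 eps2 (x j)) ->
  moffar_estimates p K L khigh flow nu0 theta1 theta2 vtheta
    (fun j => enorm (s j)) (fun j => enorm (gradient f (x j)))
    (fun j => - lambda_min (hessian f (x j))) (fun j => f (x j)) sigma nu.
Proof.
move=> hn p1 fC fflow L0 fL k0 fk n0 t1 t2 vtP [_ nu_0 sigma_0 run] nonterm.
have /andP[vt0 vt1] := vtP.
have {}run k : (k <= K)%N -> _ :=
  fun kK => run k (fun j jk => nonterm j (leq_trans jk kK)).
have step j : (j <= K)%N -> _ := fun jK =>
  let: And4 _ sc _ _ := run j jK in
  step_conditions_estimates hn p1 L0 fC (fL^~ (x j)) (fk^~ (x j)) sc.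
have xS j : (j <= K)%N -> x j.+1 = x j + s j by move=> /run[].
have nuS j : (j <= K)%N -> nu j.+1 = nu j + nu j * enorm (s j) ^+ p.+1.
  by move=> /run[].
have nu_gt0 j : (j <= K.+1)%N -> 0 < nu j.
  elim: j => [|j IH] jK; first by rewrite nu_0.
  by rewrite nuS// ltr_wpDr ?IH ?(ltnW jK)// mulr_ge0 ?exprn_ge0 ?enorm_ge0//
    ltW ?IH ?(ltnW jK).
have sigma_lb j : (j <= K)%N -> vtheta * nu j <= sigma j.
  case: j => [_|j jK]; last by have [/(_ isT)/andP[]] := run _ jK.
  by rewrite nu_0 sigma_0 ler_piMl// ltW.
have sigma_ge0 j : (j <= K)%N -> 0 <= sigma j.
  by move=> jK; rewrite (le_trans _ (sigma_lb j jK))// mulr_ge0 ?ltW ?nu_gt0//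
    leqW.
split=> //; try by [exact: lt_trans ltr01 _ | move=> j; exact: enorm_ge0].
- move=> j jK; rewrite sigma_lb//=.
  case: j jK => [_|j jK]; first by rewrite le_max nu_0 sigma_0 lexx.
  have [/(_ isT)/andP[_ +] _ _ _] := run _ jK; move=> /le_trans; apply.
  have jK' := ltnW jK; have [r0 _ grad eig _] := step j jK'.
  rewrite -(xS j jK') in grad eig.
  rewrite !ge_max !le_max lexx /=; apply/andP; split; apply/orP; right.
    rewrite /mu1 lerBlDr ler_pdivrMr ?exprn_gt0// mulrC.
    by rewrite -ler_pdivlMr ?ltr0n ?fact_gt0// mulrAC.
  rewrite /mu2 lerBlDr ler_pdivrMr ?exprn_gt0// mulrC.
  rewrite -ler_pdivlMr ?ltr0n ?fact_gt0// mulrAC ge_max eig andbT.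
  (* The branch 0 of the maximum in [mu2]: the right-hand side is nonnegative. *)
  rewrite !mulr_ge0 ?exprn_ge0 ?enorm_ge0 ?invr_ge0//.
  by rewrite addr_ge0// mulr_ge0 ?sigma_ge0// (le_trans ler01)// ltW.
- by move=> j jK; rewrite xS//; have [] := step j jK.
- by move=> j jK; rewrite xS//; have [] := step j jK.
- by move=> j jK; rewrite xS//; have [] := step j jK.
- by move=> j jK; have [] := step j jK.
Qed.

(** * Termination and the iteration count *)

Theorem theorem4p3 (R : realType) (n p : nat) (hn : (1 <= n)%N) (hp : (1 < p)%N)
    (f : 'rV[R]_n -> R) (flow Lp khigh : R)
    (f_Cp : Ck p f)
    (f_bounded_below : forall x, flow <= f x)
    (Lp_ge0 : 0 <= Lp)
    (f_Lipschitz : forall x y : 'rV[R]_n,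
      tnorm (fun vs : p.-tuple 'rV[R]_n => nabla f x vs - nabla f y vs)
        <= Lp * enorm (x - y))
    (khigh_le0 : khigh <= 0)
    (f_khigh : forall (i : nat) (x d : 'rV[R]_n), (2 <= i <= p)%N ->
      enorm d <= 1 -> khigh <= tapp (nabla (i := i) f x) d)
    (x0 : 'rV[R]_n) (nu0 eps1 eps2 theta1 theta2 vtheta : R)
    (nu0_gt0 : 0 < nu0)
    (eps1_range : 0 < eps1 <= 1) (eps2_range : 0 < eps2 <= 1)
    (theta1_gt1 : 1 < theta1) (theta2_gt1 : 1 < theta2)
    (vtheta_range : 0 < vtheta <= 1)
    (x s : nat -> 'rV[R]_n) (sigma nu : nat -> R)
    (run : moffar_run p f x0 nu0 eps1 eps2 theta1 theta2 vtheta x s sigma nu) :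
  exists k : nat,
    [/\ forall j : nat, (j < k)%N -> ~ second_order_point f eps1 eps2 (x j),
        second_order_point f eps1 eps2 (x k)
      & k.+1%:R <= moffar_bound p (f x0 - flow) (enorm (gradient f x0))
                     Lp khigh eps1 eps2 theta1 theta2 vtheta nu0 (sigma 0%N)].
Proof.
have [x_0 _ sigma_0 _] := run.
have /andP[eps10 _] := eps1_range; have /andP[eps20 _] := eps2_range.
have /andP[vt0 _] := vtheta_range.
rewrite sigma_0 /moffar_bound.
set M := Num.max (eps1 `^ _) (eps2 `^ _).
set A := kappa_moffar _ _ _ _ _ _ _ _ _ _ * _; set B := 2 * Lp / _ * _.
have count K : (forall j, (j <= K)%N ->
    ~ second_order_point f eps1 eps2 (x j)) -> K%:R <= A * M.
  move=> nonterm.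
  have E := run_estimates hn hp f_Cp f_bounded_below Lp_ge0 f_Lipschitz
    khigh_le0 f_khigh nu0_gt0 theta1_gt1 theta2_gt1 vtheta_range run nonterm.
  have := iteration_count E hp eps10 eps20; rewrite x_0; apply.
  move=> j jK; have [gle|] := leP (enorm (gradient f (x j.+1))) eps1;
    last by left.
  right; rewrite ltNge; apply/negP => lle; apply: (nonterm j.+1 jK).
  by split=> //; rewrite lerNl.
have M0 : 0 <= M by rewrite le_max powR_ge0.
have A0 : 0 <= A * M.
  rewrite mulr_ge0// mulr_ge0 ?kappa_moffar_ge0//.
  by rewrite total_gap_ge0 ?subr_ge0.
have BM0 : 0 <= B * M.
  rewrite mulr_ge0// mulr_ge0 ?le_max ?powR_ge0//.
  rewrite divr_ge0 ?mulr_ge0 ?exprn_ge0 ?(ltW vt0)//.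
  by rewrite /kappa_both le_min !powR_ge0.
(* A run that never terminates would give K <= A M for every K, against the Archimedean property. *)
have [k0 k0P] : exists k, second_order_point f eps1 eps2 (x k).
  apply: contrapT => /forallNP nonterm.
  have := archi_boundP A0; rewrite ltNge => /negP; apply.
  by apply: count => j _; exact: nonterm.
have exk : exists k, `[< second_order_point f eps1 eps2 (x k) >].
  by exists k0; exact/asboolP.
have [k /asboolP kP kmin] := ex_minnP exk.
have nonterm j : (j < k)%N -> ~ second_order_point f eps1 eps2 (x j).
  by move=> jk /asboolP /kmin; rewrite leqNgt jk.
exists k; split=> //.
(* If the first success has index k + 1, then x_0, ..., x_k fail and [count] gives k <= A M. The k +
   2 evaluated points account for the final + 2. *)
rewrite mulrDl -addrA; case: k {kP kmin} nonterm => [|k] nonterm; first lra.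
have := count k nonterm; rewrite -[k.+2%:R]/((2 + k)%N%:R) natrD; lra.
Qed.
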